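(* Let $\mathcal H$ be a separable right quaternionic Hilbert space with $\dim_{\mathbb H}\mathcal H=\infty$, let $T=T^*\in\mathcal B(\mathcal H)$, and let $E$ be the spectral measure of $T$. Then $$\sigma_e^S(T)=\sigma_S(T)\setminus\sigma_d^S(T),$$ and $$\sigma_e^S(T)=\Big\{\lambda\in\sigma_S(T):\ \lambda\ \text{is not isolated in}\ \sigma_S(T),\ \text{or}\ \dim_{\mathbb H}\operatorname{ran}\big(E(\{\lambda\})\big)=\infty\Big\}.$$ Equivalently (to the first equality), $\sigma_S(T)=\sigma_W^S(T)\cup\sigma_d^S(T)$ with $\sigma_S(T)\setminus\sigma_W^S(T)=\sigma_d^S(T)$.
   Context: A right quaternionic Hilbert space $\mathcal H$ is a right $\mathbb H$-module with an $\mathbb H$-valued inner product that is right linear in the second argument, hermitian, positive definite, and complete for $\|x\|=\langle x,x\rangle^{1/2}$. $\mathcal B(\mathcal H)$ is the real unital Banach algebra of bounded right linear operators on $\mathcal H$, $T^*$ is the adjoint, $\mathrm{Id}$ the identity. $\dim_{\mathbb H}W$ is the cardinality of an orthonormal basis of a closed right submodule $W$. For $q\in\mathbb H$ put $Q_q(T)=T^2-2\operatorname{Re}(q)T+|q|^2\mathrm{Id}$. The $S$-spectrum is $\sigma_S(T)=\{q\in\mathbb H: Q_q(T)\text{ is not invertible in }\mathcal B(\mathcal H)\}$; the same definition is used for restrictions of $T$ to closed invariant right submodules (on $\{0\}$ it is empty). For self-adjoint $T$ one has $\sigma_S(T)\subset\mathbb R$. The sphere of $q$ is $[q]=\{\operatorname{Re}(q)+I|\operatorname{Im}(q)|: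 I\in\mathbb H,\ I^2=-1\}$ (so $[\lambda]=\{\lambda\}$ for real $\lambda$). An operator $A\in\mathcal B(\mathcal H)$ is Fredholm, $A\in\Phi(\mathcal H)$, if $\operatorname{ran}(A)$ is closed, $\dim_{\mathbb H}\ker(A)<\infty$ and $\dim_{\mathbb H}\ker(A^* )<\infty$; its index is $\operatorname{ind}(A)=\dim_{\mathbb H}\ker(A)-\dim_{\mathbb H}\ker(A^* )$, and $\Phi_0(\mathcal H)$ is the set of Fredholm operators of index $0$. Set $\sigma_e^S(T)=\{q\in\mathbb H: Q_q(T)\notin\Phi(\mathcal H)\}$ and $\sigma_W^S(T)=\{q\in\mathbb H: Q_q(T)\notin\Phi_0(\mathcal H)\}$. The discrete $S$-spectrum $\sigma_d^S(T)$ is the set of right eigenvalues of finite type: those $q\in\sigma_S(T)$ for which $\mathcal H=\mathcal H_1\oplus\mathcal H_2$ is a topological direct sum of closed $T$-invariant right submodules with $\dim_{\mathbb H}\mathcal H_1<\infty$, $\sigma_S(T|_{\mathcal H_1})\cap\sigma_S(T|_{\mathcal H_2})=\varnothing$ and $\sigma_S(T|_{\mathcal H_1})=[q]$. The spectral measure of $T=T^*$ is the unique projection-valued measure $E$ on the Borel sets of $\mathbb R$ (values orthogonal projections in $\mathcal B(\mathcal H)$, $E(\mathbb R)=\mathrm{Id}$, $E(B_1\cap B_2)=E(B_1)E(B_2)$, strongly countably additive) with $T=\int_{\mathbb R}t\,dE(t)$; it has support $\sigma_S(T)$ (existence and uniqueness are the known quaternionic spectral theorem). *)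

(* Defs.v *)
From HB Require Import structures.
From mathcomp Require Import all_boot all_order all_algebra.
From mathcomp Require Import all_classical all_reals all_analysis.
From mathcomp Require Import ring.

Set Implicit Arguments.
Unset Strict Implicit.
Unset Printing Implicit Defensive.
Import Order.TTheory GRing.Theory Num.Theory numFieldNormedType.Exports.
Local Open Scope classical_set_scope.
Local Open Scope ring_scope.
Local Open Scope card_scope.

Record quat (R : Type) := Quat { qre : R; qi : R; qj : R; qk : R }.

Section QuatRing.
Variable R : realType.
Implicit Types p q r : quat R.

Definition prod_of_quat q := (qre q, qi q, qj q, qk q).
Definition quat_of_prod (u : R * R * R * R) := Quat u.1.1.1 u.1.1.2 u.1.2 u.2.
Lemma prod_of_quatK : cancel prod_of_quat quat_of_prod.
Proof. by case. Qed.

HB.instance Definition _ := Choice.copy (quat R) (can_type prod_of_quatK).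

Definition addq p q :=
  Quat (qre p + qre q) (qi p + qi q) (qj p + qj q) (qk p + qk q).
Definition oppq p := Quat (- qre p) (- qi p) (- qj p) (- qk p).
Definition mulq p q := Quat
  (qre p * qre q - qi p * qi q - qj p * qj q - qk p * qk q)
  (qre p * qi q + qi p * qre q + qj p * qk q - qk p * qj q)
  (qre p * qj q - qi p * qk q + qj p * qre q + qk p * qi q)
  (qre p * qk q + qi p * qj q - qj p * qi q + qk p * qre q).
Definition qreal (a : R) := Quat a 0 0 0.

Fact addqA : associative addq.
Proof. by move=> p q r; rewrite /addq /= !addrA. Qed.
Fact addqC : commutative addq.
Proof. by move=> p q; rewrite /addq; congr Quat; rewrite addrC. Qed.
Fact add0q : left_id (qreal 0) addq.
Proof. by case=> a b c d; rewrite /addq /= !add0r. Qed.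
Fact addNq : left_inverse (qreal 0) oppq addq.
Proof. by move=> p; rewrite /addq /= !addNr. Qed.
HB.instance Definition _ :=
  GRing.isZmodule.Build (quat R) addqA addqC add0q addNq.

Fact mulqA : associative mulq.
Proof. by move=> p q r; rewrite /mulq /=; congr Quat; ring. Qed.
Fact mul1q : left_id (qreal 1) mulq.
Proof. by case=> a b c d; rewrite /mulq /=; congr Quat; ring. Qed.
Fact mulq1 : right_id (qreal 1) mulq.
Proof. by case=> a b c d; rewrite /mulq /=; congr Quat; ring. Qed.
Fact mulqDl : left_distributive mulq addq.
Proof. by move=> p q r; rewrite /mulq /addq /=; congr Quat; ring. Qed.
Fact mulqDr : right_distributive mulq addq.
Proof. by move=> p q r; rewrite /mulq /addq /=; congr Quat; ring. Qed.
Fact oneq_neq0 : qreal 1 != 0 :> quat R.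
Proof. by apply/eqP => -[] /eqP; rewrite oner_eq0. Qed.
HB.instance Definition _ := GRing.Zmodule_isNzRing.Build (quat R)
  mulqA mul1q mulq1 mulqDl mulqDr oneq_neq0.

Definition qconj q := Quat (qre q) (- qi q) (- qj q) (- qk q).
Definition qim q := Quat 0 (qi q) (qj q) (qk q).
Definition qabs q :=
  Num.sqrt (qre q ^+ 2 + qi q ^+ 2 + qj q ^+ 2 + qk q ^+ 2).

Definition qsphere q : set (quat R) :=
  [set qreal (qre q) + I * qreal (qabs (qim q)) | I in [set I | I * I = -1]].

End QuatRing.

(* The structure sits on top of the real Banach space obtained by restricting
   the scalars to the real quaternions, whose norm is <x, x>^(1/2). *)
HB.mixin Record isQHilbert (R : realType) (V : Type)
    of CompleteNormedModule R V := {
  rscale : V -> quat R -> V ;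
  rscaleA : forall x a b, rscale x (a * b) = rscale (rscale x a) b ;
  rscale_real : forall x (r : R), rscale x (qreal r) = r *: x ;
  rscaleDl : forall x y a, rscale (x + y) a = rscale x a + rscale y a ;
  rscaleDr : forall x a b, rscale x (a + b) = rscale x a + rscale x b ;
  qinner : V -> V -> quat R ;
  qinnerDr : forall x y z, qinner x (y + z) = qinner x y + qinner x z ;
  qinnerZr : forall x y a, qinner x (rscale y a) = qinner x y * a ;
  qinner_conj : forall x y, qinner y x = qconj (qinner x y) ;
  qinner_gt0 : forall x, x != 0 -> 0 < qre (qinner x x) ;
  norm_qinner : forall x : V, `|x| = Num.sqrt (qre (qinner x x))
}.

#[short(type="qhilbertType")]
HB.structure Definition QHilbert (R : realType) :=
  {V of CompleteNormedModule R V & isQHilbert R V}.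

Infix "**" := rscale (at level 40, left associativity) : ring_scope.

Section Operators.
Variables (R : realType) (H : qhilbertType R).
Implicit Types (x y : H) (W : set H) (A S T : H -> H) (q : quat R).

Definition rsubmodule W :=
  W 0 /\ forall x y a, W x -> W y -> W (x ** a + y).
Definition closed_rsubmodule W := closed W /\ rsubmodule W.

(* The elements of B(W), as functions on H of which only the values on W
   matter; B(H) is bounded_op_on setT. *)
Definition bounded_op_on W A :=
  [/\ forall x, W x -> W (A x),
      forall x y a, W x -> W y -> A (x ** a + y) = A x ** a + A y
    & exists M : R, forall x, W x -> `|A x| <= M * `|x|].
Definition bounded_op A := bounded_op_on setT A.

Definition invertible_on W A :=
  exists2 S, bounded_op_on W S & forall x, W x -> S (A x) = x /\ A (S x) = x.

(* By Riesz there is exactly one such operator when A is in B(H). *)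
Definition adjoint A : H -> H :=
  xget (fun=> 0)
    [set S | bounded_op S /\ forall x y, qinner (A x) y = qinner x (S y)].

Definition qpoly T q x : H :=
  T (T x) - (2 * qre q) *: T x + qabs q ^+ 2 *: x.

Definition sspectrum_on W T : set (quat R) :=
  [set q | ~ invertible_on W (qpoly T q)].
Definition sspectrum T := sspectrum_on setT T.

Definition orthonormal_basis W (B : set H) :=
  [/\ B `<=` W,
      forall x y, B x -> B y -> qinner x y = if x == y then 1 else 0
    & closure (smallest rsubmodule B) = W].

Definition has_qdim W (n : nat) :=
  exists2 B, orthonormal_basis W B & B #= `I_n.
Definition finite_qdim W := exists n, has_qdim W n.
Definition qdim W : nat := xget 0%N [set n | has_qdim W n].

Definition qker A : set H := [set x | A x = 0].

Definition fredholm A :=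
  [/\ bounded_op A, closed (range A), finite_qdim (qker A)
    & finite_qdim (qker (adjoint A))].
Definition fredholm_index A : int :=
  (qdim (qker A))%:Z - (qdim (qker (adjoint A)))%:Z.
Definition fredholm0 A := fredholm A /\ fredholm_index A = 0.

Definition ess_sspectrum T : set (quat R) := [set q | ~ fredholm (qpoly T q)].
Definition weyl_sspectrum T : set (quat R) :=
  [set q | ~ fredholm0 (qpoly T q)].

Definition topological_direct_sum W1 W2 :=
  W1 `&` W2 = [set 0] /\
  exists2 P, bounded_op P & forall x, W1 (P x) /\ W2 (x - P x).

Definition discrete_sspectrum T : set (quat R) :=
  [set q | sspectrum T q /\ exists W1 W2,
    [/\ closed_rsubmodule W1 /\ closed_rsubmodule W2,
        (forall x, W1 x -> W1 (T x)) /\ (forall x, W2 x -> W2 (T x)),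
        topological_direct_sum W1 W2,
        finite_qdim W1
      & sspectrum_on W1 T `&` sspectrum_on W2 T = set0
        /\ sspectrum_on W1 T = qsphere q]].

Definition orthogonal_projection A :=
  [/\ bounded_op A, A \o A = A & adjoint A = A].

Definition projection_valued_measure (E : set R -> H -> H) :=
  [/\ forall B, measurable B -> orthogonal_projection (E B),
      E setT = id,
      forall B1 B2, measurable B1 -> measurable B2 ->
        E (B1 `&` B2) = E B1 \o E B2
    & forall F : nat -> set R, (forall n, measurable (F n)) ->
        trivIset setT F -> forall x,
        (fun n => \sum_(0 <= i < n) E (F i) x) @ \oo --> E (\bigcup_n F n) x].

(* T = \int t dE(t) in the weak sense: <x, T x> = \int t d<x, E(t) x> for
   every x.  For self-adjoint T this determines <x, T y> for all x, y by
   polarization.  The right-hand side is only finite when t is integrable,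
   since +oo - oo is -oo in \bar R. *)
Definition spectral_measure T (E : set R -> H -> H) :=
  projection_valued_measure E /\
  forall x, (qre (qinner x (T x)))%:E =
    (\int[fun B => (qre (qinner x (E B x)))%:E]_t (t : R)%:E)%E.

End Operators.

(* Main.v *)
(* For q with non-zero imaginary part, Q_q(T) = (T - Re q)^2 + |Im q|^2 is
   coercive and hence invertible, so only real points l matter, and there
   Q_l(T) = (T - l)^2.  Each Q_q(T) is self-adjoint, so its index is 0 and the
   Weyl and essential spectra coincide.  The weak integral formula for T shows
   that E(B) commutes with T and that T - m has norm at most d on
   ran E([m - d, m + d]); hence ran E({l}) = ker (T - l), and E vanishes locally
   off the spectrum.

   The common criterion is a spectral gap: T - l is bounded below on ker E({l}).
   A point of the spectrum is isolated iff it has a gap, and (T - l)^2 is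
   Fredholm iff l has a gap and ran E({l}) is finite dimensional.  If
   ran (T - l)^2 is closed, it contains ker E({l}), because it contains
   ran E(B) whenever B stays away from l; so (T - l)^2 + E({l}) is a symmetric
   bijection, which is invertible by Banach-Steinhaus.  Finally a gap yields the
   decomposition ran E({l}) + ker E({l}) required for a discrete point, while
   for a discrete point the range of (T - l)^2 is the preimage, under a bounded
   projection, of a finitely generated and hence closed submodule. *)
From HB Require Import structures.
From mathcomp Require Import all_boot all_order all_algebra.
From mathcomp Require Import all_classical all_reals all_analysis.
From mathcomp Require Import measurable_realfun ring lra.
Require Import Defs.
Set Implicit Arguments.
Unset Strict Implicit.
Unset Printing Implicit Defensive.
Import Order.TTheory GRing.Theory Num.Theory numFieldNormedType.Exports.
Local Open Scope classical_set_scope.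
Local Open Scope ring_scope.

(** * The real inner product underlying the quaternionic one *)

Section RealInnerProduct.
Variables (R : realType) (H : qhilbertType R).
Implicit Types (x y z : H) (q a : quat R) (r : R).

Definition rin x y : R := qre (qinner x y).

Lemma quat_eq (p q : quat R) : qre p = qre q -> qi p = qi q -> qj p = qj q ->
  qk p = qk q -> p = q.
Proof. by case: p => ????; case: q => ????/= -> -> -> ->. Qed.

Lemma rscale1 x : x ** 1 = x.
Proof. by rewrite (_ : 1 = qreal 1)// rscale_real scale1r. Qed.

Lemma rscale0 x : x ** 0 = 0.
Proof. by rewrite (_ : 0 = qreal 0)// rscale_real scale0r. Qed.

Lemma rscale0l a : (0 : H) ** a = 0.
Proof. by apply: (addrI (0 ** a)); rewrite -rscaleDl addr0 addr0. Qed.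

Lemma qrealC r a : qreal r * a = a * qreal r.
Proof. by apply: quat_eq => /=; ring. Qed.

Lemma scale_rscale r x a : r *: (x ** a) = (r *: x) ** a.
Proof. by rewrite -!rscale_real -!rscaleA qrealC. Qed.

Lemma rinC x y : rin x y = rin y x.
Proof. by rewrite /rin [qinner x y]qinner_conj. Qed.

Lemma rinDr x y z : rin x (y + z) = rin x y + rin x z.
Proof. by rewrite /rin qinnerDr. Qed.

Lemma rinZr x r y : rin x (r *: y) = r * rin x y.
Proof. by rewrite /rin -rscale_real qinnerZr /=; ring. Qed.

Lemma rinDl x y z : rin (x + y) z = rin x z + rin y z.
Proof. by rewrite rinC rinDr !(rinC z). Qed.

Lemma rinZl r x y : rin (r *: x) y = r * rin x y.
Proof. by rewrite rinC rinZr rinC. Qed.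

Lemma rinNr x y : rin x (- y) = - rin x y.
Proof. by rewrite -scaleN1r rinZr mulN1r. Qed.

Lemma rinNl x y : rin (- x) y = - rin x y.
Proof. by rewrite rinC rinNr rinC. Qed.

Lemma rinBr x y z : rin x (y - z) = rin x y - rin x z.
Proof. by rewrite rinDr rinNr. Qed.

Lemma rinBl x y z : rin (x - y) z = rin x z - rin y z.
Proof. by rewrite rinDl rinNl. Qed.

Lemma rin0r x : rin x 0 = 0.
Proof. by rewrite -(scale0r 0) rinZr mul0r. Qed.

Lemma rin0l x : rin 0 x = 0.
Proof. by rewrite rinC rin0r. Qed.

Lemma rin_ge0 x : 0 <= rin x x.
Proof.
by have [->|x0] := eqVneq x 0; [rewrite rin0r | exact/ltW/qinner_gt0].
Qed.

Lemma rinxx x : rin x x = `|x| ^+ 2.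
Proof. by rewrite norm_qinner sqr_sqrtr //; exact: rin_ge0. Qed.

Lemma rinP x : (forall y, rin y x = 0) -> x = 0.
Proof.
by move=> /(_ x); rewrite rinxx => /eqP; rewrite sqrf_eq0 normr_eq0 => /eqP.
Qed.

(** Cauchy-Schwarz, by expanding the squared norm of [y] minus its projection on [x]. *)
Lemma rin_le x y : `|rin x y| <= `|x| * `|y|.
Proof.
have [->|x0] := eqVneq x 0; first by rewrite rin0l !normr0 mul0r.
rewrite -(@ler_pXn2r _ 2)// ?nnegrE ?mulr_ge0// exprMn real_normK ?num_real//.
have := rin_ge0 (y - (rin x y / `|x| ^+ 2) *: x).
rewrite rinBr !rinBl rinZl !rinZr rinZl !rinxx (rinC y x).
have n0 : 0 < `|x| ^+ 2 by rewrite exprn_gt0 // normr_gt0.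
set n := `|x| ^+ 2 in n0 *; set m := `|y| ^+ 2; set s := rin x y.
have -> : m - s / n * s - (s / n * s - s / n * (s / n * n)) = m - s ^+ 2 / n.
  by field; rewrite gt_eqF.
by rewrite subr_ge0 ler_pdivrMr // mulrC.
Qed.

(** An imaginary component of a quaternion is minus the real part of its right multiple by the
    matching unit, and right linearity moves that unit into [y]. Statements about [rin] thus lift to
    [qinner]. *)
Lemma qinner_rin x y : qinner x y =
  Quat (rin x y) (- rin x (y ** Quat 0 1 0 0)) (- rin x (y ** Quat 0 0 1 0))
    (- rin x (y ** Quat 0 0 0 1)).
Proof. by rewrite /rin !qinnerZr; apply: quat_eq => /=; ring. Qed.

Lemma qinnerZl x y a : qinner (x ** a) y = qconj a * qinner x y.
Proof.
rewrite qinner_conj qinnerZr [qinner x y]qinner_conj.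
by apply: quat_eq => /=; ring.
Qed.

Lemma norm_rscale x a : `|x ** a| = `|x| * qabs a.
Proof.
apply/eqP; rewrite -(@eqrXn2 _ 2)//; last by rewrite mulr_ge0 ?sqrtr_ge0.
rewrite exprMn /qabs sqr_sqrtr; last by rewrite !addr_ge0 ?sqr_ge0.
rewrite -!rinxx /rin qinnerZr qinnerZl; apply/eqP.
(* Hermitian symmetry makes the imaginary parts of [qinner x x] equal to their opposites. *)
have := qinner_conj x x; case: (qinner x x) => w u v t [] hu hv ht.
have -> : u = 0 by lra.
have -> : v = 0 by lra.
have -> : t = 0 by lra.
by rewrite /=; ring.
Qed.

Lemma normDsq x y : `|x + y| ^+ 2 = `|x| ^+ 2 + 2 * rin x y + `|y| ^+ 2.
Proof. by rewrite -!rinxx rinDr !rinDl (rinC y x); ring. Qed.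

Lemma normD_orth x y : rin x y = 0 -> `|x + y| ^+ 2 = `|x| ^+ 2 + `|y| ^+ 2.
Proof. by move=> xy; rewrite normDsq xy mulr0 addr0. Qed.

Lemma cvg_rin x (u : H ^nat) l : u @ \oo --> l ->
  (fun n => rin x (u n)) @ \oo --> rin x l.
Proof.
move=> ul; apply/cvgrPdist_le => e e0.
have d0 : 0 < e / (`|x| + 1) by rewrite divr_gt0 // ltr_wpDl.
move/cvgrPdist_le : ul => /(_ _ d0); apply: filterS => n /= h.
rewrite -rinBr (le_trans (rin_le _ _))//.
rewrite (le_trans (ler_wpM2l (normr_ge0 _) h))// mulrCA ler_piMr ?(ltW e0)//.
by rewrite ler_pdivrMr ?ltr_wpDl// mul1r lerDl.
Qed.

End RealInnerProduct.

(** * Bounded right linear operators, symmetry and coercivity *)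

Section BoundedOperators.
Variables (R : realType) (H : qhilbertType R).
Implicit Types (x y z : H) (q a : quat R) (r : R) (A B P S T : H -> H).

(** Stated for the real form only; [symmetric_qinner] recovers the quaternionic identity for bounded
    operators. *)
Definition symmetric_op A := forall x y, rin (A x) y = rin x (A y).

Lemma bop_on0 (W : set H) A : rsubmodule W -> bounded_op_on W A -> A 0 = 0.
Proof.
move=> [W0 _] [_ lin _]; have := lin 0 0 1 W0 W0.
by rewrite !rscale1 !addr0 => /esym h; apply: (addrI (A 0)); rewrite h addr0.
Qed.

Section Linear.
Variable A : H -> H.
Hypothesis bA : bounded_op A.

Lemma bopD x y : A (x + y) = A x + A y.
Proof. by case: bA => _ /(_ x y 1); rewrite !rscale1 => ->. Qed.

Lemma bop0 : A 0 = 0.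
Proof. by apply: (addrI (A 0)); rewrite -bopD !addr0. Qed.

Lemma bopZq x a : A (x ** a) = A x ** a.
Proof. by case: bA => _ /(_ x 0 a I I) + _; rewrite bop0 !addr0. Qed.

Lemma bopZ r x : A (r *: x) = r *: A x.
Proof. by rewrite -!rscale_real bopZq. Qed.

Lemma bopN x : A (- x) = - A x.
Proof. by rewrite -scaleN1r bopZ scaleN1r. Qed.

Lemma bopB x y : A (x - y) = A x - A y.
Proof. by rewrite bopD bopN. Qed.

Lemma bop_bound : exists2 M : R, 0 < M & forall x, `|A x| <= M * `|x|.
Proof.
case: bA => _ _ [M hM]; exists (Num.max M 1).
  by rewrite lt_max ltr01 orbT.
by move=> x; rewrite (le_trans (hM x I))// ler_wpM2r// le_max lexx.
Qed.

Lemma bop_continuous : continuous A.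
Proof.
have [M M0 hM] := bop_bound.
move=> x; apply/cvgrPdist_le => e e0.
have := @nbhsx_ballx _ _ x (e / M) (divr_gt0 e0 M0).
apply: filterS => y; rewrite -ball_normE /= => h.
by rewrite -bopB (le_trans (hM _))// mulrC -ler_pdivlMr// ltW.
Qed.

End Linear.

Lemma bop_comp A B : bounded_op A -> bounded_op B -> bounded_op (A \o B).
Proof.
move=> bA bB; split=> //.
  by move=> x y a _ _ /=; rewrite (bopD bB) (bopD bA) (bopZq bB) (bopZq bA).
have [M M0 hM] := bop_bound bA; have [N N0 hN] := bop_bound bB.
exists (M * N) => x _ /=; rewrite (le_trans (hM _))// -mulrA.
by rewrite ler_wpM2l// ltW.
Qed.

Lemma bop_add A B : bounded_op A -> bounded_op B ->
  bounded_op (fun x => A x + B x).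
Proof.
move=> bA bB; split=> //.
  move=> x y a _ _ /=; rewrite (bopD bB) (bopD bA) (bopZq bB) (bopZq bA).
  by rewrite rscaleDl addrACA.
have [M M0 hM] := bop_bound bA; have [N N0 hN] := bop_bound bB.
exists (M + N) => x _ /=; rewrite (le_trans (ler_normD _ _))// mulrDl.
by rewrite lerD.
Qed.

Lemma bop_scale r A : bounded_op A -> bounded_op (fun x => r *: A x).
Proof.
move=> bA; split=> //.
  move=> x y a _ _ /=; rewrite (bopD bA) (bopZq bA).
  by rewrite scalerDr scale_rscale.
have [M M0 hM] := bop_bound bA.
exists (`|r| * M) => x _ /=; rewrite normrZ -mulrA.
by rewrite ler_wpM2l.
Qed.

Lemma bop_id : bounded_op (id : H -> H).
Proof. by split=> //; exists 1 => x _; rewrite mul1r. Qed.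

Lemma bop_opp A : bounded_op A -> bounded_op (fun x => - A x).
Proof.
move=> /(bop_scale (-1)); congr bounded_op; apply: funext => x.
by rewrite scaleN1r.
Qed.

Lemma symmetric_qinner A : bounded_op A -> symmetric_op A ->
  forall x y, qinner (A x) y = qinner x (A y).
Proof.
by move=> bA sA x y; rewrite !qinner_rin -!(bopZq bA) !sA.
Qed.

Lemma symmetric_adjoint A : bounded_op A -> symmetric_op A -> adjoint A = A.
Proof.
move=> bA sA; apply: xget_unique.
  by split => //; exact: symmetric_qinner.
move=> S [bS AS]; apply: funext => x; apply/eqP; rewrite -subr_eq0.
by apply/eqP/rinP => y; rewrite rinBr -(sA y) /rin AS subrr.
Qed.

(* [adjoint] returns the zero map when there is no adjoint, and that map is
   symmetric as well. *)
Lemma adjoint_symmetric A : adjoint A = A -> symmetric_op A.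
Proof.
rewrite /adjoint; case: xgetP => [S _ [_ AS] SA x y|_ <- x y].
  by rewrite /rin AS SA.
by rewrite rin0l rin0r.
Qed.

(* For small t > 0 the map [x |-> x - t (B x - y)] is a contraction. *)
Lemma coercive_surjective B c : bounded_op B -> 0 < c ->
  (forall x, c * `|x| ^+ 2 <= rin x (B x)) -> forall y, exists x, B x = y.
Proof.
move=> bB c0 hc y; have [M0 M00 hM0] := bop_bound bB.
(* A bound of at least [c] keeps [k] below nonnegative. *)
pose M := Num.max M0 c.
have M_gt0 : 0 < M by rewrite lt_max M00.
have hM x : `|B x| <= M * `|x|.
  by rewrite (le_trans (hM0 x))// ler_wpM2r// le_max lexx.
(* The squared Lipschitz constant of [f] is at most 1 - 2 t c + t^2 M^2; this [t] minimizes it, with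
   minimum [k]. *)
pose t := c / M ^+ 2; pose f x := x - t *: (B x - y).
pose k := 1 - c ^+ 2 / M ^+ 2.
have k0 : 0 <= k.
  rewrite subr_ge0 ler_pdivrMr ?exprn_gt0// mul1r.
  rewrite ler_pXn2r ?nnegrE ?(ltW c0) ?(ltW M_gt0)//.
  by rewrite le_max lexx orbT.
have k1 : k < 1 by rewrite ltrBlDr ltrDl divr_gt0 ?exprn_gt0.
have fk x x' : `|f x - f x'| <= Num.sqrt k * `|x - x'|.
  have -> : f x - f x' = (x - x') - t *: B (x - x').
    have -> : B (x - x') = (B x - y) - (B x' - y).
      by rewrite (bopB bB) opprB addrA subrK.
    by rewrite scalerBr opprD opprK addrACA opprB [- _ + _]addrC.
  set u := x - x'; rewrite -(@ler_pXn2r _ 2)// ?nnegrE ?mulr_ge0 ?sqrtr_ge0//.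
  rewrite exprMn sqr_sqrtr// normDsq normrN rinNr rinZr normrZ exprMn.
  rewrite real_normK ?num_real//.
  have h1 := hc u.
  
  have h2 : `|B u| ^+ 2 <= M ^+ 2 * `|u| ^+ 2.
    by rewrite -exprMn ler_pXn2r ?nnegrE ?mulr_ge0 ?(ltW M_gt0).
  have h3 : t ^+ 2 * `|B u| ^+ 2 <= c ^+ 2 / M ^+ 2 * `|u| ^+ 2.
    rewrite (le_trans (ler_wpM2l (sqr_ge0 _) h2))//.
    rewrite le_eqVlt; apply/orP; left; apply/eqP; rewrite /t; field.
    by rewrite gt_eqF.
  have h4 : c ^+ 2 / M ^+ 2 * `|u| ^+ 2 <= t * rin u (B u).
    rewrite (le_trans _ (ler_wpM2l _ h1))//; last first.
      by rewrite divr_ge0 ?ltW// exprn_gt0.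
    rewrite le_eqVlt; apply/orP; left; apply/eqP; rewrite /t; field.
    by rewrite gt_eqF.
  rewrite /k mulrBl mul1r; lra.
pose F : {fun [set: H] >-> [set: H]} :=
  HB.pack f (isFun.Build _ _ setT setT f (fun _ _ => Logic.I)).
have sk1 : Num.sqrt k < 1 by rewrite -sqrtr1 ltr_sqrt.
have [] := @banach_fixed_point _ H setT F _ closedT (ex_intro _ 0 Logic.I).
  exists (NngNum (sqrtr_ge0 k)); split => //= -[x x'] _ /=.
  exact: fk.
move=> x _ /= /esym/eqP; rewrite /f -subr_eq0 addrAC subrr add0r oppr_eq0.
rewrite scaler_eq0 gt_eqF ?divr_gt0 ?exprn_gt0//= subr_eq0 => /eqP Bx.
by exists x.
Qed.

(** Cauchy-Schwarz turns coercivity into a lower bound [c] for [B], which gives injectivity and the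
    bound 1/c on the inverse. *)
Lemma coercive_invertible B c : bounded_op B -> 0 < c ->
  (forall x, c * `|x| ^+ 2 <= rin x (B x)) -> invertible_on setT B.
Proof.
move=> bB c0 hc.
have hn x : c * `|x| <= `|B x|.
  have [->|x0] := eqVneq x 0; first by rewrite normr0 mulr0.
  rewrite -(@ler_pM2l _ `|x|) ?normr_gt0//.
  rewrite mulrCA -expr2 (le_trans (hc x))// (le_trans (ler_norm _))//.
  exact: rin_le.
have injB x y : B x = B y -> x = y.
  move=> Bxy; apply/eqP; rewrite -subr_eq0 -normr_le0.
  by rewrite -(@ler_pM2l _ c)// mulr0 (le_trans (hn _))// (bopB bB) Bxy subrr normr0.
have /choice [S hS] := coercive_surjective bB c0 hc.
exists S; last by move=> x _; split=> //; apply: injB; rewrite hS.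
split => //.
  by move=> x y a _ _; apply: injB; rewrite (bopD bB) (bopZq bB) !hS.
exists c^-1 => x _; rewrite -(@ler_pM2l _ c)// mulrA divff ?gt_eqF// mul1r.
by rewrite (le_trans (hn _))// hS.
Qed.

End BoundedOperators.

(** * Finitely generated right submodules *)

Section FiniteDimension.
Variables (R : realType) (H : qhilbertType R).
Implicit Types (x y z u v w : H) (a : quat R) (s t : seq H) (W : set H).

Fixpoint rspan s : set H :=
  if s is v :: s' then [set v ** a + w | a in [set: quat R] & w in rspan s']
  else [set 0].

Lemma rspan_rsubmodule s : rsubmodule (rspan s).
Proof.
elim: s => [|v s [s0 sD]] /=.
  by split=> // _ _ a -> ->; rewrite rscale0l addr0.
split; first by exists 0 => //; exists 0 => //; rewrite rscale0 addr0.
move=> _ _ a [b _ [w sw <-]] [c _ [w' sw' <-]].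
exists (b * a + c) => //; exists (w ** a + w'); first exact: sD.
by rewrite rscaleDl -rscaleA rscaleDr addrACA.
Qed.

Lemma rsubmoduleD W x y : rsubmodule W -> W x -> W y -> W (x + y).
Proof. by move=> [_ WD] Wx Wy; rewrite -[x]rscale1; exact: WD. Qed.

Lemma rsubmoduleZ W x a : rsubmodule W -> W x -> W (x ** a).
Proof. by move=> [W0 WD] Wx; rewrite -[_ ** _]addr0; exact: WD. Qed.

Lemma rsubmoduleB W x y : rsubmodule W -> W x -> W y -> W (x - y).
Proof.
move=> sW Wx Wy; apply: rsubmoduleD => //.
by rewrite -scaleN1r -rscale_real; exact: rsubmoduleZ.
Qed.

Lemma mem_rspan s v : v \in s -> rspan s v.
Proof.
elim: s => //= w s IH; rewrite inE => /predU1P[->|/IH sv].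
  by exists 1 => //; exists 0; [exact: (rspan_rsubmodule s).1|rewrite rscale1 addr0].
by exists 0 => //; exists v; rewrite // rscale0 add0r.
Qed.

Lemma rspan_min W s : rsubmodule W -> (forall v, v \in s -> W v) -> rspan s `<=` W.
Proof.
move=> sW; elim: s => /= [_ _ ->|v s IH sub]; first exact: sW.1.
move=> _ [a _ [w sw <-]]; apply: sW.2; first by apply: sub; rewrite mem_head.
by apply: IH => // u us; apply: sub; rewrite inE us orbT.
Qed.

Lemma smallest_rspan s : smallest (@rsubmodule R H) [set` s] = rspan s.
Proof.
apply/seteqP; split=> x.
  by apply; split; [exact: rspan_rsubmodule|move=> v; exact: mem_rspan].
by move=> sx W [sW sub]; apply: rspan_min sx.
Qed.

Lemma image_rspan (A : H -> H) s : A 0 = 0 ->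
  (forall v w a, rspan s v -> rspan s w -> A (v ** a + w) = A v ** a + A w) ->
  A @` rspan s = rspan (map A s).
Proof.
move=> A0; elim: s => [_|v s IH lin] /=; first by rewrite image_set1 A0.
have sub x : rspan s x -> rspan (v :: s) x.
  by move=> sx; exists 0 => //; exists x; rewrite // rscale0 add0r.
have sv : rspan (v :: s) v by apply: mem_rspan; rewrite mem_head.
rewrite -IH => [|? ? ? /sub ? /sub ?]; last exact: lin.
apply/seteqP; split=> z /=.
  move=> [_ [a _ [w sw <-]] <-]; exists a => //; exists (A w); first by exists w.
  by rewrite lin//; exact: sub.
move=> [a _ [_ [w sw <-] <-]]; exists (v ** a + w).
  by exists a => //; exists w.
by rewrite lin//; exact: sub.
Qed.

Definition orthoseq s := forall x y, x \in s -> y \in s ->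
  qinner x y = if x == y then 1 else 0.

(** For an orthonormal list without repetitions this is the orthogonal projection onto the span. *)
Definition proj_seq s x := \sum_(e <- s) e ** qinner e x.

Lemma bop_proj_seq s : bounded_op (proj_seq s).
Proof.
elim: s => [|e s IH].
  rewrite (_ : proj_seq _ = fun=> 0).
    split=> //; first by move=> *; rewrite rscale0l addr0.
    by exists 0 => x _; rewrite normr0 mul0r.
  by apply: funext => x; rewrite /proj_seq big_nil.
rewrite (_ : proj_seq _ = fun x => e ** qinner e x + proj_seq s x); last first.
  by apply: funext => x; rewrite /proj_seq big_cons.
apply: bop_add => //; split=> //.
  by move=> x y a _ _; rewrite qinnerDr qinnerZr rscaleDr rscaleA.
(* Multiplication by a unit quaternion is isometric, so each of the four components of [qinner e x]
   is at most |e||x|; the factor 4 generously covers their sum of squares. *)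
exists (4 * `|e| ^+ 2) => x _; rewrite norm_rscale.
have -> : 4 * `|e| ^+ 2 * `|x| = `|e| * (4 * (`|e| * `|x|)) by ring.
rewrite ler_wpM2l//.
have unit_le q : qabs q = 1 -> `|rin e (x ** q)| <= `|e| * `|x|.
  by move=> q1; rewrite (le_trans (rin_le _ _))// norm_rscale q1 mulr1.
rewrite qinner_rin /qabs /=.
have le0 := rin_le e x.
have q1 (q : quat R) : qre q ^+ 2 + qi q ^+ 2 + qj q ^+ 2 + qk q ^+ 2 = 1 -> qabs q = 1.
  by rewrite /qabs => ->; rewrite sqrtr1.
set m := `|e| * `|x| in le0 *.
have le1 : `|rin e (x ** Quat 0 1 0 0)| <= m.
  by apply/unit_le/q1 => /=; ring.
have le2 : `|rin e (x ** Quat 0 0 1 0)| <= m.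
  by apply/unit_le/q1 => /=; ring.
have le3 : `|rin e (x ** Quat 0 0 0 1)| <= m.
  by apply/unit_le/q1 => /=; ring.
have m0 : 0 <= m by rewrite mulr_ge0.
have sq r : `|r| <= m -> r ^+ 2 <= m ^+ 2.
  by move=> rm; rewrite -[r ^+ 2]real_normK ?num_real// ler_pXn2r ?nnegrE.
rewrite -(@ler_pXn2r _ 2)// ?nnegrE ?sqrtr_ge0 ?mulr_ge0//.
rewrite [leLHS]sqr_sqrtr ?addr_ge0 ?sqr_ge0// !sqrrN exprMn.
have := sq _ le0; have := sq _ le1; have := sq _ le2; have := sq _ le3.
by have := sqr_ge0 m; lra.
Qed.

Lemma proj_seq_in s x : rspan s (proj_seq s x).
Proof.
have sW := rspan_rsubmodule s.
rewrite /proj_seq big_seq; elim/big_ind: _ => [|u v|e es]; first exact: sW.1.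
  exact: rsubmoduleD.
by apply: rsubmoduleZ => //; exact: mem_rspan.
Qed.

Lemma proj_seq_orth s e x : uniq s -> orthoseq s -> e \in s ->
  qinner e (x - proj_seq s x) = 0.
Proof.
move=> us os es.
have qB u v : qinner e (u - v) = qinner e u - qinner e v.
  rewrite qinnerDr -scaleN1r -rscale_real qinnerZr; congr (_ + _).
  by apply: quat_eq => /=; ring.
rewrite qB.
have -> : qinner e (proj_seq s x) = \sum_(f <- s) qinner e f * qinner f x.
  rewrite /proj_seq; elim: (s) => [|f r IH].
    by rewrite !big_nil -(rscale0 0) qinnerZr mulr0.
  by rewrite !big_cons qinnerDr qinnerZr IH.
rewrite (bigD1_seq e)//= (os e e)// eqxx mul1r big_seq_cond big1 ?addr0 ?subrr// => f.
by case/andP => fs fe; rewrite (os e f)// eq_sym (negbTE fe) mul0r.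
Qed.

Lemma rspan_orth s y z : (forall e, e \in s -> qinner e z = 0) -> rspan s y ->
  qinner y z = 0.
Proof.
move=> ez; have qc0 : qconj 0 = 0 :> quat R by apply: quat_eq; rewrite /= ?oppr0.
elim: s ez y => [_ y ->|e s IH ez _ [a _ [w sw <-]]] /=.
  by rewrite qinner_conj -(rscale0 z) qinnerZr mulr0 qc0.
have ezw : qinner z (e ** a) = 0.
  by rewrite qinnerZr qinner_conj ez ?mem_head// qc0 mul0r.
have zw : qinner z w = 0.
  by rewrite qinner_conj IH// => f fs; apply: ez; rewrite inE fs orbT.
by rewrite qinner_conj qinnerDr ezw zw addr0.
Qed.

(** The residual lies in the span and is orthogonal to it, hence to itself. *)
Lemma proj_seq_id s x : uniq s -> orthoseq s -> rspan s x -> proj_seq s x = x.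
Proof.
move=> us os sx; apply/eqP; rewrite eq_sym -subr_eq0 -normr_eq0 -sqrf_eq0 -rinxx /rin.
rewrite (@rspan_orth s)//; first by move=> e; exact: proj_seq_orth.
by apply: rsubmoduleB => //; [exact: rspan_rsubmodule|exact: proj_seq_in].
Qed.

(** If the residual [w] of the new vector [v] vanishes, [v] is already in the span; otherwise [w] is
    normalized and prepended. *)
Lemma gram_schmidt s : exists t, [/\ uniq t, orthoseq t & rspan t = rspan s].
Proof.
elim: s => [|v s [t [ut ot ts]]]; first by exists [::].
pose w := v - proj_seq t v.
have Etv : v = w + proj_seq t v by rewrite subrK.
have vst : rspan (v :: s) = rspan (v :: t) by rewrite /= ts.
have [w0|w0] := eqVneq w 0.
  exists t; split=> //; rewrite vst; apply/seteqP; split=> x.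
    by move=> tx; exists 0 => //; exists x; rewrite // rscale0 add0r.
  apply: rspan_min; first exact: rspan_rsubmodule.
  move=> u; rewrite inE => /predU1P[->|]; last exact: mem_rspan.
  by rewrite Etv w0 add0r; exact: proj_seq_in.
pose u := `|w|^-1 *: w.
have ew e : e \in t -> qinner e w = 0 by exact: proj_seq_orth.
have eu e : e \in t -> qinner e u = 0.
  by move=> et; rewrite /u -rscale_real qinnerZr ew// mul0r.
have ue e : e \in t -> qinner u e = 0.
  by move=> et; rewrite qinner_conj eu//; apply: quat_eq; rewrite /= ?oppr0.
have uu : qinner u u = 1.
  have nu : `|u| = 1 by rewrite normrZ normfV normr_id mulVf// normr_eq0.
  have := rinxx u; rewrite nu /rin; have := qinner_conj u u.
  case: (qinner u u) => a b c d [] hb hc hd /= ->.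
  by apply: quat_eq => /=; rewrite ?expr1n; lra.
have ut' : u \notin t.
  apply/negP => /eu; rewrite uu => /eqP; by rewrite oner_eq0.
have sut := rspan_rsubmodule (u :: t); have svt := rspan_rsubmodule (v :: t).
have tvt x : rspan t x -> rspan (v :: t) x.
  by move=> tx; exists 0 => //; exists x; rewrite // rscale0 add0r.
have tut x : rspan t x -> rspan (u :: t) x.
  by move=> tx; exists 0 => //; exists x; rewrite // rscale0 add0r.
exists (u :: t); split; first by rewrite /= ut'.
  move=> x y; rewrite !inE => /predU1P[->|xt] /predU1P[->|yt].
  - by rewrite eqxx.
  - by rewrite ue//; case: eqP => // uy; rewrite -uy (negbTE ut') in yt.
  - by rewrite eu//; case: eqP => // uy; rewrite uy (negbTE ut') in xt.
  - exact: ot.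
rewrite vst; apply/seteqP; split; apply: rspan_min => // x; rewrite inE.
  move=> /predU1P[->|/mem_rspan /tvt//].
  rewrite /u -rscale_real; apply: rsubmoduleZ => //; apply: rsubmoduleB => //.
    by apply: mem_rspan; rewrite mem_head.
  by apply: tvt; exact: proj_seq_in.
move=> /predU1P[->|/mem_rspan /tut//].
rewrite Etv; apply: rsubmoduleD => //; last by apply: tut; exact: proj_seq_in.
have -> : w = u ** qreal `|w|.
  by rewrite rscale_real scalerA divff ?scale1r// normr_eq0.
by apply: rsubmoduleZ => //; apply: mem_rspan; rewrite mem_head.
Qed.

Lemma closed_qker (A : H -> H) : bounded_op A -> closed (qker A).
Proof.
move=> bA; apply: (@preimage_closed _ _ A [set 0]).
  by move=> x _; exact: bop_continuous.
by apply: accessible_closed_set1; apply: hausdorff_accessible; exact: norm_hausdorff.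
Qed.

Lemma closed_fixpoints (A : H -> H) : bounded_op A -> closed [set x | A x = x].
Proof.
move=> bA; have -> : [set x | A x = x] = qker (fun x => A x - x).
  apply/seteqP; split=> x /=; first by rewrite /qker /= => ->; rewrite subrr.
  by rewrite /qker /= => /eqP; rewrite subr_eq0 => /eqP.
by apply: closed_qker; apply: bop_add => //; apply: bop_opp; exact: bop_id.
Qed.

(** After orthonormalization the span is the fixed-point set of a bounded projection. *)
Lemma closed_rspan s : closed (rspan s).
Proof.
have [t [ut ot <-]] := gram_schmidt s.
have -> : rspan t = [set x | proj_seq t x = x].
  by apply/seteqP; split=> x /=; [exact: proj_seq_id|move=> <-; exact: proj_seq_in].
by apply: closed_fixpoints; exact: bop_proj_seq.
Qed.

Lemma finite_qdim_rspan s : finite_qdim (rspan s).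
Proof.
have [t [ut ot <-]] := gram_schmidt s.
have /finite_setP [n tn] : finite_set [set` t] by apply/finite_seqP; exists t.
exists n; exists [set` t] => //; split; first by move=> x; exact: mem_rspan.
  by move=> x y; exact: ot.
by rewrite smallest_rspan; apply/esym/closure_id; exact: closed_rspan.
Qed.

(** Trades Hilbert bases for finite generation; [closed_rspan] absorbs the closure in
    [orthonormal_basis]. *)
Lemma finite_qdimP W : finite_qdim W <-> exists s, W = rspan s.
Proof.
split=> [[n [B [_ _ <-] Bn]]|[s ->]]; last exact: finite_qdim_rspan.
have /finite_seqP [s ->] : finite_set B by apply/finite_setP; exists n.
by exists s; rewrite smallest_rspan; apply/esym/closure_id; exact: closed_rspan.
Qed.

End FiniteDimension.

(** * Inverses and norm bounds for symmetric operators *)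

Section SymmetricOperators.
Variables (R : realType) (H : qhilbertType R).

(* Hellinger-Toeplitz: the inverse is symmetric, so the functionals
   <B^-1 x, .> with |x| <= 1 are pointwise bounded. *)
Lemma symmetric_bijective_invertible (B : H -> H) :
  bounded_op B -> symmetric_op B -> (forall y, exists x, B x = y) ->
  (forall x, B x = 0 -> x = 0) -> invertible_on setT B.
Proof.
move=> bB sB /choice[S BS] B0.
have injB x y : B x = B y -> x = y.
  move=> Bxy; apply/eqP; rewrite -subr_eq0; apply/eqP/B0.
  by rewrite (bopB bB) Bxy subrr.
have SB x : S (B x) = x by apply: injB; rewrite BS.
have sS x y : rin (S x) y = rin x (S y) by rewrite -{1}(BS y) -sB BS.
have Slin x y (a : quat R) : S (x ** a + y) = S x ** a + S y.
  by apply: injB; rewrite (bopD bB) (bopZq bB) !BS.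
exists S; last by move=> x _; rewrite SB BS.
split => //.
have [] := @Banach_Steinhauss R H R^o
    [set f | exists2 x, `|x| <= 1 & f = (fun y => rin (S x) y)] _ _ 1.
- move=> _ [x _ ->]; split.
    move=> r; exists (`|S x| * r) => y yr.
    by rewrite (le_trans (rin_le _ _))// ler_wpM2l.
  by move=> k u v; rewrite rinDr rinZr.
- move=> y; exists `|S y| => _ [x x1 ->]; rewrite sS (le_trans (rin_le _ _))//.
  by rewrite ler_piMl.
move=> M hM.
have SZ (r : R) x : S (r *: x) = r *: S x.
  have S0 : S 0 = 0 by apply: injB; rewrite BS (bop0 bB).
  by rewrite -!rscale_real -[_ ** _]addr0 Slin S0 addr0.
have h1 x : `|x| <= 1 -> `|S x| <= M.
  move=> x1; have [->|Sx0] := eqVneq (S x) 0.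
    have := hM _ (ex_intro2 _ _ x x1 erefl) 0; rewrite !normr0 => /(_ ler01).
    exact: le_trans.
  have n0 : 0 < `|S x| by rewrite normr_gt0.
  (* The functional of [x] takes the value |S x| at the unit vector along [S x]. *)
  have := hM _ (ex_intro2 _ _ x x1 erefl) (`|S x|^-1 *: S x).
  rewrite normrZ normfV normr_id mulVf ?gt_eqF// => /(_ (lexx _)).
  rewrite rinZr rinxx expr2 mulrA mulVf ?gt_eqF// mul1r normr_id //.
exists M => x _; have [->|x0] := eqVneq x 0.
  have := h1 0; rewrite normr0 => /(_ ler01).
  by have := SZ 0 0; rewrite !scale0r => ->; rewrite normr0 mulr0.
have n0 : 0 < `|x| by rewrite normr_gt0.
have := h1 (`|x|^-1 *: x).
rewrite normrZ normfV normr_id mulVf ?gt_eqF// => /(_ (lexx _)).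
by rewrite SZ normrZ normfV normr_id ler_pdivrMl// mulrC.
Qed.

(** Put y = S x / d. The forms at x + y and x - y differ by 4 |S x|^2 / d, and the parallelogram law
    bounds the difference by 2 d |x|^2 + 2 |S x|^2 / d. Only two vectors are tested, so the lemma
    applies inside an invariant subspace. *)
Lemma numerical_radius_le (S : H -> H) (d : R) x :
  bounded_op S -> symmetric_op S -> 0 < d ->
  `|rin (x + d^-1 *: S x) (S (x + d^-1 *: S x))|
    <= d * `|x + d^-1 *: S x| ^+ 2 ->
  `|rin (x - d^-1 *: S x) (S (x - d^-1 *: S x))|
    <= d * `|x - d^-1 *: S x| ^+ 2 ->
  `|S x| <= d * `|x|.
Proof.
move=> bS sS d0; set t := d^-1; set y := t *: S x.
have yE : rin y (S x) = t * `|S x| ^+ 2 by rewrite rinZl rinxx.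
have xE : rin x (S y) = t * `|S x| ^+ 2 by rewrite -sS rinZr rinxx.
have nyE : `|y| ^+ 2 = t ^+ 2 * `|S x| ^+ 2.
  by rewrite normrZ exprMn real_normK ?num_real.
rewrite (bopB bS) (bopD bS) !normDsq normrN rinNr !rinDr !rinDl.
rewrite !rinNr !rinNl yE xE nyE.
rewrite !ler_norml => /andP[_ h2] /andP[h1 _].
have h3 : 2 * t * `|S x| ^+ 2 <= d * `|x| ^+ 2 + d * t ^+ 2 * `|S x| ^+ 2.
  by lra.
have dt : d * t ^+ 2 = t by rewrite /t; field; rewrite gt_eqF.
rewrite dt in h3.
have h4 : t * `|S x| ^+ 2 <= d * `|x| ^+ 2 by lra.
rewrite -(@ler_pXn2r _ 2)// ?nnegrE ?mulr_ge0 ?(ltW d0)//.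
have {h4} := ler_wpM2l (ltW d0) h4.
by rewrite /t mulrA divff ?gt_eqF// mul1r mulrA -expr2 exprMn.
Qed.

End SymmetricOperators.

(** * The operators Q_q(T) for symmetric T *)

Section SelfAdjoint.
Variables (R : realType) (H : qhilbertType R) (T : H -> H).
Hypotheses (bT : bounded_op T) (sT : symmetric_op T).
Implicit Types (x y z : H) (q : quat R) (l m : R).

Definition Tsub l x : H := T x - l *: x.

Lemma bop_Tsub l : bounded_op (Tsub l).
Proof. by apply: bop_add => //; apply: bop_opp; apply: bop_scale; exact: bop_id. Qed.

Lemma sym_Tsub l : symmetric_op (Tsub l).
Proof. by move=> x y; rewrite /Tsub rinBl rinBr rinZl rinZr sT. Qed.

Definition qnormim q : R := qi q ^+ 2 + qj q ^+ 2 + qk q ^+ 2.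

Lemma qpolyE q x :
  qpoly T q x = Tsub (qre q) (Tsub (qre q) x) + qnormim q *: x.
Proof.
rewrite /qpoly /qabs sqr_sqrtr ?addr_ge0 ?sqr_ge0//.
have -> : qre q ^+ 2 + qi q ^+ 2 + qj q ^+ 2 + qk q ^+ 2 = qre q ^+ 2 + qnormim q.
  by rewrite /qnormim !addrA.
rewrite scalerDl addrA; congr (_ + _).
rewrite /Tsub (bopB bT) (bopZ bT) scalerBr scalerA -expr2 opprB addrA.
rewrite [RHS]addrAC; congr (_ + _).
by rewrite -addrA -opprD -scalerDl mulr_natl mulr2n.
Qed.

Lemma qpoly_real l x : qpoly T (qreal l) x = Tsub l (Tsub l x).
Proof. by rewrite qpolyE /qnormim /= !expr0n /= !addr0 scale0r addr0. Qed.

Lemma bop_qpoly q : bounded_op (qpoly T q).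
Proof.
have -> : qpoly T q = fun x => (Tsub (qre q) \o Tsub (qre q)) x + qnormim q *: x.
  by apply: funext => x; rewrite qpolyE.
by apply: bop_add; [apply: bop_comp; exact: bop_Tsub|apply: bop_scale; exact: bop_id].
Qed.

Lemma sym_qpoly q : symmetric_op (qpoly T q).
Proof. by move=> x y; rewrite !qpolyE rinDl rinDr !sym_Tsub rinZl rinZr. Qed.

Lemma adjoint_qpoly q : adjoint (qpoly T q) = qpoly T q.
Proof. by apply: symmetric_adjoint; [exact: bop_qpoly|exact: sym_qpoly]. Qed.

Lemma rin_qpoly q x : rin x (qpoly T q x) =
  `|Tsub (qre q) x| ^+ 2 + qnormim q * `|x| ^+ 2.
Proof. by rewrite qpolyE rinDr rinZr -sym_Tsub !rinxx. Qed.

Lemma qpoly_coercive q c : 0 < c ->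
  (forall x, c * `|x| ^+ 2 <= `|Tsub (qre q) x| ^+ 2 + qnormim q * `|x| ^+ 2) ->
  ~ sspectrum T q.
Proof.
move=> c0 hc; apply; apply: (coercive_invertible (bop_qpoly q) c0) => x.
by rewrite rin_qpoly.
Qed.

Lemma sspectrum_real q : sspectrum T q -> q = qreal (qre q).
Proof.
move=> sq; have [n0|n0] := ltrP 0 (qnormim q).
  exfalso; apply: (qpoly_coercive n0) sq => x.
  by rewrite lerDr sqr_ge0.
have := sqr_ge0 (qi q); have := sqr_ge0 (qj q); have := sqr_ge0 (qk q).
rewrite /qnormim in n0 => h1 h2 h3.
have z (r : R) : r ^+ 2 = 0 -> r = 0 by move=> /eqP; rewrite sqrf_eq0 => /eqP.
by apply: quat_eq => //=; apply: z; lra.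
Qed.

(** The form of (T - l)^2 at [x] is |(T - l) x|^2. *)
Lemma qker_qpoly_real l : qker (qpoly T (qreal l)) = qker (Tsub l).
Proof.
apply/seteqP; split=> x; rewrite /qker /=.
  move=> Qx; have := rin_qpoly (qreal l) x.
  rewrite Qx rin0r /qnormim /= !expr0n /= !addr0 mul0r addr0 => /esym/eqP.
  by rewrite sqrf_eq0 normr_eq0 => /eqP.
by rewrite qpoly_real => ->; exact: (bop0 (bop_Tsub l)).
Qed.

Lemma fredholmP q : fredholm (qpoly T q) <->
  closed (range (qpoly T q)) /\ finite_qdim (qker (qpoly T q)).
Proof.
rewrite /fredholm adjoint_qpoly; split=> [[]|[]] //.
by split=> //; exact: bop_qpoly.
Qed.

Lemma fredholm0P q : fredholm0 (qpoly T q) <-> fredholm (qpoly T q).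
Proof.
rewrite /fredholm0 /fredholm_index adjoint_qpoly subrr.
by split=> [[]|].
Qed.

Lemma invertible_fredholm q : ~ sspectrum T q -> fredholm (qpoly T q).
Proof.
move=> /contrapT [S bS SQ]; apply/fredholmP; split.
  rewrite (_ : range _ = setT); first exact: closedT.
  by apply/seteqP; split=> // y _; exists (S y) => //; exact: (SQ y I).2.
rewrite (_ : qker _ = rspan [::]); first exact: finite_qdim_rspan.
apply/seteqP; split=> x /=; last by move=> ->; exact: (bop0 (bop_qpoly q)).
by move=> Qx; rewrite -(SQ x I).1 Qx (bop0 bS).
Qed.

End SelfAdjoint.

(** * Integrals against set functions *)

Section EqIntegral.
Import HBNNSimple.

(* [eq_measure_integral] for set functions that need not be measures, as in the
   definition of [spectral_measure]. *)
Lemma eq_integral_measurable d (X : measurableType d) (R : realType)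
    (D : set X) (m1 m2 : set X -> \bar R) (f : X -> \bar R) :
  (forall B, measurable B -> m1 B = m2 B) ->
  (\int[m1]_(t in D) f t = \int[m2]_(t in D) f t)%E.
Proof.
move=> m12.
have e (h : {nnsfun X >-> R}) : sintegral m1 h = sintegral m2 h.
  by apply: eq_fsbigr => r _; rewrite m12.
rewrite /integral; congr (ereal_sup _ - ereal_sup _)%E.
- by apply/seteqP; split=> _ [h hf <-]; exists h.
- by apply/seteqP; split=> _ [h hf <-]; exists h.
Qed.

End EqIntegral.

(** * Projection-valued measures and their scalar measures *)

Section SpectralMeasure.
Variables (R : realType) (H : qhilbertType R) (T : H -> H).
Variable E : set R -> H -> H.
Hypotheses (bT : bounded_op T) (sT : symmetric_op T) (TE : spectral_measure T E).
Implicit Types (x y z : H) (B C : set R) (r l m a b d : R).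

Let pvm : projection_valued_measure E. Proof. exact: TE.1. Qed.

Lemma pvm_bounded B : measurable B -> bounded_op (E B).
Proof. by case: pvm => + _ _ _ mB => /(_ _ mB)[]. Qed.

Lemma pvm_symmetric B : measurable B -> symmetric_op (E B).
Proof. by case: pvm => + _ _ _ mB => /(_ _ mB)[_ _]; exact: adjoint_symmetric. Qed.

Lemma pvm_setI B C x : measurable B -> measurable C -> E (B `&` C) x = E B (E C x).
Proof. by case: pvm => _ _ h _ mB mC; rewrite h. Qed.

Lemma pvm_idem B x : measurable B -> E B (E B x) = E B x.
Proof. by move=> mB; rewrite -pvm_setI// setIid. Qed.

Lemma pvm_setT x : E setT x = x.
Proof. by case: pvm => _ ->. Qed.

(** Additivity over a sequence of empty sets gives a convergent series with constant terms, so these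
    are 0. *)
Lemma pvm_set0 x : E set0 x = 0.
Proof.
case: pvm => _ _ _ /(_ (fun=> set0) (fun=> measurable0)).
have t0 : trivIset [set: nat] (fun=> set0 : set R) by move=> ? ? _ _ [? []].
move=> /(_ t0 x) h.
have /cvg_series_cvg_0 : cvgn (series (fun=> E set0 x)).
  by apply/cvg_ex; eexists; exact: h.
by move/(cvg_lim (@norm_hausdorff _ _)); rewrite lim_cst//; exact: norm_hausdorff.
Qed.

Lemma rin_pvm B x : measurable B -> rin x (E B x) = `|E B x| ^+ 2.
Proof. by move=> mB; rewrite -rinxx pvm_symmetric// pvm_idem. Qed.

(** The scalar spectral measure of [x]: strong additivity passes through the continuous functional
    [rin x], and [rin x (E B x)] is |E B x|^2. *)
Lemma pvm_measure x : exists mu : {measure set R -> \bar R},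
  forall B, mu B = (`|E B x| ^+ 2)%:E.
Proof.
pose mu B : \bar R := (`|E B x| ^+ 2)%:E.
have mu0 : mu set0 = 0%E by rewrite /mu pvm_set0 normr0 expr0n.
have mu_ge0 B : (0 <= mu B)%E by rewrite lee_fin sqr_ge0.
have mu_add : semi_sigma_additive mu.
  move=> F mF tF mUF.
  have -> : (fun n => \sum_(0 <= i < n) mu (F i))%E =
      EFin \o (fun n => rin x (\sum_(0 <= i < n) E (F i) x)).
    apply: funext => n /=; rewrite sumEFin; congr EFin.
    elim: n => [|n IH]; first by rewrite !big_nil rin0r.
    by rewrite !big_nat_recr//= rinDr IH rin_pvm.
  apply/fine_cvgP; split; first exact: nearW.
  rewrite /= -rin_pvm//; apply: cvg_rin.
  by case: pvm => _ _ _; exact.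
exists (HB.pack_for {measure set R -> \bar R} mu
  (isMeasure.Build _ _ _ mu mu0 mu_ge0 mu_add)) => //.
Qed.

(** The two set functions are only known to agree on measurable sets, where [E B] is a
    projection. *)
Lemma integral_pvm x (mu : {measure set R -> \bar R}) :
    (forall B, mu B = (`|E B x| ^+ 2)%:E) ->
  (\int[mu]_t (t : R)%:E)%E = (rin x (T x))%:E.
Proof.
move=> muE; rewrite [RHS]TE.2; apply: eq_integral_measurable => B mB.
by rewrite muE -rin_pvm.
Qed.

(** The difference of the integrals of the positive and negative parts is a real number, which
    forces both to be finite. *)
Lemma integrable_pvm x (mu : {measure set R -> \bar R}) :
    (forall B, mu B = (`|E B x| ^+ 2)%:E) -> mu.-integrable setT (@EFin R).
Proof.
move=> /integral_pvm; rewrite integralE => h.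
apply/integrableP; split; first exact: EFin_measurable.
have -> : (\int[mu]_t `|t%:E| = \int[mu]_t ((EFin ^\+ \+ EFin ^\-) t))%E.
  by apply: eq_integral => t _; exact: (congr1 (@^~ t) (fune_abse (@EFin R))).
rewrite ge0_integralD//; last 2 first.
- by apply: measurable_funepos; exact: EFin_measurable.
- by apply: measurable_funeneg; exact: EFin_measurable.
move: h; have := @integral_ge0 _ _ _ mu setT (EFin ^\+)%E (fun t _ => funepos_ge0 _ _).
have := @integral_ge0 _ _ _ mu setT (EFin ^\-)%E (fun t _ => funeneg_ge0 _ _).
case: (\int[mu]_t _)%E => [p||]//; case: (\int[mu]_t _)%E => [n||]//= _ _ _.
by rewrite -EFinD ltry.
Qed.

Lemma integrable_cst_pvm x (mu : {measure set R -> \bar R}) a :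
    (forall B, mu B = (`|E B x| ^+ 2)%:E) -> mu.-integrable setT (cst a%:E).
Proof.
move=> muE; apply/integrableP; split; first exact: measurable_cst.
by rewrite /= integral_cst// muE -EFinM ltry.
Qed.

(** The scalar measure of [x] has mass |x|^2 and does not charge ]-oo, a[, so the integral of t is
    compared with that of a. *)
Lemma form_ge a x : E `]-oo, a[%classic x = 0 -> a * `|x| ^+ 2 <= rin x (T x).
Proof.
move=> Ex; have [mu muE] := pvm_measure x.
have mN : measurable `]-oo, a[%classic by exact: measurable_itv.
have N0 : mu `]-oo, a[%classic = 0%E by rewrite muE Ex normr0 expr0n.
have ia := integrable_cst_pvm a muE; have iT := integrable_pvm muE.
rewrite -lee_fin -(integral_pvm muE) -(pvm_setT x) EFinM -muE -integral_cst//.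
rewrite (negligible_integral mN _ ia)// (negligible_integral mN _ iT)//.
have mD : measurable ([set: R] `\` `]-oo, a[%classic) by exact: measurableD.
apply: le_integral => //.
- by apply: integrableS ia.
- by apply: integrableS iT.
- move=> t; rewrite inE /= in_itv/= => -[_ /negP]; rewrite -leNgt => h.
  by rewrite lee_fin.
Qed.

Lemma form_le b x : E `]b, +oo[%classic x = 0 -> rin x (T x) <= b * `|x| ^+ 2.
Proof.
move=> Ex; have [mu muE] := pvm_measure x.
have mN : measurable `]b, +oo[%classic by exact: measurable_itv.
have N0 : mu `]b, +oo[%classic = 0%E by rewrite muE Ex normr0 expr0n.
have ib := integrable_cst_pvm b muE; have iT := integrable_pvm muE.
rewrite -lee_fin -(integral_pvm muE) -(pvm_setT x) EFinM -muE -integral_cst//.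
rewrite (negligible_integral mN _ ib)// (negligible_integral mN _ iT)//.
have mD : measurable ([set: R] `\` `]b, +oo[%classic) by exact: measurableD.
apply: le_integral => //.
- by apply: integrableS iT.
- by apply: integrableS ib.
- move=> t; rewrite inE /= in_itv/= andbT => -[_ /negP]; rewrite -leNgt => h.
  by rewrite lee_fin.
Qed.

Lemma pvm_disjoint B C x : measurable B -> measurable C -> B `&` C = set0 ->
  E B (E C x) = 0.
Proof. by move=> mB mC BC; rewrite -pvm_setI// BC pvm_set0. Qed.

Lemma pvm_setC B x : measurable B -> x = E B x + E (~` B) x.
Proof.
move=> mB; have mC : measurable (~` B) by exact: measurableC.
have [mu muE] := pvm_measure x.
have : (mu B + mu (~` B) = mu setT)%E.
  by rewrite -measureU ?setICr// setUCr.
rewrite !muE pvm_setT -EFinD => -[h].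
apply/eqP; rewrite -subr_eq0 -normr_eq0 -sqrf_eq0 normDsq normrN rinNr.
rewrite normD_orth; last by rewrite pvm_symmetric// pvm_disjoint ?setICr ?rin0r.
rewrite rinDr !rin_pvm//; apply/eqP; lra.
Qed.

Lemma pvm_subset B C x : measurable B -> measurable C -> B `<=` C -> E C x = 0 ->
  E B x = 0.
Proof.
move=> mB mC BC Cx; rewrite -(setIidl BC) pvm_setI// Cx; exact: (bop0 (pvm_bounded mB)).
Qed.

Lemma pvm_bigcup (F : nat -> set R) B x : (forall n, measurable (F n)) ->
  measurable B -> B `<=` \bigcup_n F n -> (forall n, E (F n) x = 0) -> E B x = 0.
Proof.
move=> mF mB BF F0; have [mu muE] := pvm_measure x.
have := measure_sigma_subadditive mu mF mB BF.
rewrite eseries0 => [|n _ _]; last by rewrite muE F0 normr0 expr0n.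
rewrite muE lee_fin => h; apply/eqP; rewrite -normr_eq0 -sqrf_eq0.
by rewrite eq_le h sqr_ge0.
Qed.

(** [E C y] and [E C z] are orthogonal for each measurable [C], so the scalar measure of y + z is
    the sum of those of y and z. The form of [T] is then additive on this pair, and its cross term
    vanishes. *)
Lemma form_split B y z : measurable B -> E B y = y -> E B z = 0 ->
  rin y (T z) = 0.
Proof.
move=> mB By Bz.
have [mu muE] := pvm_measure (y + z).
have [mu1 mu1E] := pvm_measure y; have [mu2 mu2E] := pvm_measure z.
have i1 := integrable_pvm mu1E; have i2 := integrable_pvm mu2E.
have := integral_measure_add measurableT i1 i2.
rewrite (integral_pvm mu1E) (integral_pvm mu2E).
rewrite (@eq_measure_integral _ _ _ setT mu); last first.
  move=> C mC _; rewrite [LHS](measure_addE mu1 mu2 C) mu1E mu2E muE -EFinD; congr EFin.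
  rewrite (bopD (pvm_bounded mC)) normD_orth//.
  rewrite -By pvm_symmetric// pvm_idem// pvm_symmetric// -pvm_setI// setIC pvm_setI//.
  by rewrite Bz (bop0 (pvm_bounded mC)) rin0r.
rewrite (integral_pvm muE) -EFinD => -[].
rewrite (bopD bT) rinDr !rinDl (rinC z (T y)) sT; lra.
Qed.

Lemma pvm_commute B x : measurable B -> E B (T x) = T (E B x).
Proof.
move=> mB; have mC : measurable (~` B) by exact: measurableC.
have key C y : measurable C -> E C (T (E (~` C) y)) = 0.
  move=> mD; have mDC : measurable (~` C) by exact: measurableC.
  apply: rinP => w; rewrite -pvm_symmetric//; apply: (form_split mD); rewrite ?pvm_idem//.
  by rewrite pvm_disjoint// setICr.
rewrite {1}(pvm_setC x mB) (bopD bT) (bopD (pvm_bounded mB)) key// addr0.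
rewrite [RHS](pvm_setC (T (E B x)) mB).
by have := key _ x mC; rewrite setCK => ->; rewrite addr0.
Qed.

Lemma pvm_Tsub B l x : measurable B -> E B (Tsub T l x) = Tsub T l (E B x).
Proof.
by move=> mB; rewrite /Tsub (bopB (pvm_bounded mB)) pvm_commute// (bopZ (pvm_bounded mB)).
Qed.

Lemma pvm_setC_id B x : measurable B -> E B x = 0 -> E (~` B) x = x.
Proof. by move=> mB Bx; rewrite [RHS](pvm_setC x mB) Bx add0r. Qed.

Lemma norm_pvm_split B x : measurable B ->
  `|x| ^+ 2 = `|E B x| ^+ 2 + `|E (~` B) x| ^+ 2.
Proof.
move=> mB; have mC : measurable (~` B) by exact: measurableC.
rewrite {1}(pvm_setC x mB) normD_orth//.
by rewrite pvm_symmetric// pvm_disjoint ?setICr ?rin0r.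
Qed.

(** On the range of E([m - d, m + d]) the form of T - m is at most d |z|^2 in absolute value. That
    range is invariant under T - m, so it contains the two vectors that [numerical_radius_le]
    tests. *)
Lemma Tsub_le m d x : 0 < d -> E (~` `[m - d, m + d]) x = 0 ->
  `|Tsub T m x| <= d * `|x|.
Proof.
move=> d0 Ex; have mI : measurable (~` `[m - d, m + d]%classic).
  by apply: measurableC; exact: measurable_itv.
pose W z := E (~` `[m - d, m + d]) z = 0.
have Wbd z : W z -> `|rin z (Tsub T m z)| <= d * `|z| ^+ 2.
  move=> Wz; rewrite /Tsub rinBr rinZr rinxx ler_norml.
  have Ez1 : E `]-oo, (m - d)[%classic z = 0.
    apply: (pvm_subset _ mI) Wz; first exact: measurable_itv.
    by move=> t /=; rewrite !in_itv/= => td; rewrite leNgt td.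
  have Ez2 : E `]m + d, +oo[%classic z = 0.
    apply: (pvm_subset _ mI) Wz; first exact: measurable_itv.
    by move=> t /=; rewrite !in_itv/= andbT => td; rewrite [t <= _]leNgt td andbF.
  have := form_ge Ez1; have := form_le Ez2; rewrite mulrBl mulrDl; lra.
pose S := Tsub T m; have bS : bounded_op S := bop_Tsub bT m.
have WS z : W z -> W (S z).
  by rewrite /W pvm_Tsub// => ->; exact: bop0.
have Wy : W (d^-1 *: S x) by rewrite /W (bopZ (pvm_bounded mI)) (WS _ Ex) scaler0.
apply: (numerical_radius_le bS (sym_Tsub sT m) d0); apply: Wbd.
  by rewrite /W (bopD (pvm_bounded mI)) Ex Wy addr0.
by rewrite /W (bopB (pvm_bounded mI)) Ex Wy subr0.
Qed.

(** A Lindelof argument: countably many rational intervals whose projection kills [x] cover [B]. *)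
Lemma pvm_local_null B x : measurable B ->
  (forall t, B t -> exists2 e : R, 0 < e & E `[t - e, t + e]%classic x = 0) ->
  E B x = 0.
Proof.
move=> mB loc.
pose I (p : rat * rat) : set R :=
  `[ratr p.1 - ratr p.2, ratr p.1 + ratr p.2]%classic.
have mI p : measurable (I p) by exact: measurable_itv.
pose F n : set R := if unpickle n is Some p then
  if `[< E (I p) x = 0 >] then I p else set0 else set0.
apply: (@pvm_bigcup F).
- by move=> n; rewrite /F; case: unpickle => // p; case: asboolP.
- exact: mB.
- move=> t /loc[e e0 Et].
  (* A rational radius d < e/2 and a rational centre within d of t give an interval that contains t
     and lies in [t - e, t + e]. *)
  have e20 : 0 < e / 2 by rewrite divr_gt0.
  have [d] := rat_in_itvoo e20.
  rewrite in_itv/= => /andP[d0 de].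
  have td : t - ratr d < t + ratr d by lra.
  have [m] := rat_in_itvoo td.
  rewrite in_itv/= => /andP[m1 m2].
  have Im : E (I (m, d)) x = 0.
    apply: pvm_subset Et => //.
    by move=> s; rewrite /I /= !in_itv/= => /andP[s1 s2]; apply/andP; split; lra.
  exists (pickle (m, d)); first exact: Logic.I.
  rewrite /F pickleK (asboolT Im).
  by rewrite /I /= in_itv/=; apply/andP; split; lra.
- move=> n; rewrite /F; case: unpickle => [p|]; last exact: pvm_set0.
  by case: asboolP => // _; exact: pvm_set0.
Qed.

Lemma le_small_norm (a b : R) : 0 <= a -> 0 <= b ->
  (forall d, 0 < d -> a <= d * b) -> a = 0.
Proof.
move=> a0 b0 h; apply/eqP; rewrite eq_le a0 andbT leNgt; apply/negP => {}a0.
have b1 : 0 < b + 1 by rewrite ltr_wpDl.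
have := h _ (divr_gt0 a0 b1).
by rewrite -mulrA mulrC -mulrA ler_pdivlMl//; lra.
Qed.

(** Forward, [Tsub_le] bounds |(T - l) x| by d |x| for every d > 0. Backward, near t != l the vector
    y = E([t - e, t + e]) x satisfies (T - t) y = (l - t) y and |(T - t) y| <= e |y| with e = |t -
    l| / 2, so y = 0. *)
Lemma pvm_pointP l x : E [set l] x = x <-> Tsub T l x = 0.
Proof.
split=> [lx|Tx].
  apply/eqP; rewrite -normr_eq0; apply/eqP.
  apply: (@le_small_norm _ `|x|) => // d d0; apply: Tsub_le => //.
  rewrite -lx pvm_disjoint//; first by apply: measurableC; exact: measurable_itv.
  apply/seteqP; split=> // t [/= + tl]; rewrite tl in_itv/=; apply.
  by apply/andP; split; lra.
have m1 : measurable [set l] by exact: measurable_set1.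
rewrite [RHS](pvm_setC x m1) (@pvm_local_null (~` [set l])) ?addr0//.
  exact: measurableC.
move=> t /eqP tl; pose e := `|t - l| / 2.
have tl0 : 0 < `|t - l| by rewrite normr_gt0 subr_eq0.
have e0 : 0 < e by rewrite divr_gt0.
exists e => //; have mI : measurable `[t - e, t + e]%classic by exact: measurable_itv.
set y := E _ x.
have Ty : Tsub T l y = 0 by rewrite -pvm_Tsub// Tx (bop0 (pvm_bounded mI)).
have : `|Tsub T t y| <= e * `|y|.
  apply: Tsub_le => //; rewrite pvm_disjoint ?setICl//; exact: measurableC.
have -> : Tsub T t y = (l - t) *: y.
  by move: Ty; rewrite /Tsub => /eqP; rewrite subr_eq0 => /eqP ->; rewrite scalerBl.
rewrite normrZ distrC => h; apply/eqP; rewrite -normr_le0.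
have : `|t - l| / 2 * `|y| <= 0.
  by rewrite /e in h; set s := `|t - l| in h *; lra.
by rewrite pmulr_rle0 // divr_gt0.
Qed.

Lemma resolvent_null t : ~ sspectrum T (qreal t) ->
  exists2 e : R, 0 < e & forall x, E `[t - e, t + e]%classic x = 0.
Proof.
move=> /contrapT [S bS SQ]; have [M M0 hM] := bop_bound bS.
(* This makes M e < 1 and e < 1, while two uses of [Tsub_le] give |y| <= M e^2 |y|, hence y = 0. *)
pose e := (M + 1)^-1; have e0 : 0 < e by rewrite invr_gt0 addr_gt0.
exists e => // x; set y := E _ x.
have mI : measurable `[t - e, t + e]%classic by exact: measurable_itv.
have mIC : measurable (~` `[t - e, t + e]%classic) by exact: measurableC.
have yI : E (~` `[t - e, t + e]) y = 0 by rewrite pvm_disjoint ?setICl.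
have h1 := Tsub_le e0 yI.
have h2 : `|Tsub T t (Tsub T t y)| <= e * `|Tsub T t y|.
  apply: Tsub_le => //; rewrite pvm_Tsub// yI; exact: (bop0 (bop_Tsub bT t)).
have h3 := hM (qpoly T (qreal t) y); rewrite (SQ y Logic.I).1 qpoly_real// in h3.
have h4 : `|y| <= M * (e * (e * `|y|)).
  rewrite (le_trans h3)// ler_wpM2l ?(ltW M0)// (le_trans h2)//.
  by rewrite ler_wpM2l// ltW.
apply/eqP; rewrite -normr_eq0; apply/eqP/le_anti; rewrite normr_ge0 andbT.
have Me : M * e < 1 by rewrite ltr_pdivrMr ?addr_gt0// mul1r ltrDl.
have e1 : e < 1 by rewrite invf_lt1 ?addr_gt0// ltrDr.
have Mee : M * e * e < 1.
  by rewrite -[ltRHS]mulr1 ltr_pM// ?mulr_ge0 ?(ltW M0) ?(ltW e0).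
rewrite leNgt; apply/negP => y0.
by move: h4; rewrite !mulrA -[leLHS]mul1r ler_pM2r// leNgt Mee.
Qed.

(** Cut [x] at l - e. The form of T - l is at most -e |y|^2 on the lower piece and at least e |z|^2
    on the upper one; Cauchy-Schwarz bounds each norm, and the squares add up because T - l respects
    the cut. *)
Lemma Tsub_ge l e x : 0 < e -> E `]l - e, l + e[%classic x = 0 ->
  e * `|x| <= `|Tsub T l x|.
Proof.
move=> e0 Ex; have bS := bop_Tsub bT l.
have mL : measurable `]-oo, (l - e)]%classic by exact: measurable_itv.
have mLC : measurable (~` `]-oo, (l - e)]%classic) by exact: measurableC.
set y := E `]-oo, (l - e)]%classic x; set z := E (~` `]-oo, (l - e)]%classic) x.
have rin_ge w : e * `|w| ^+ 2 <= `|rin w (Tsub T l w)| -> e * `|w| <= `|Tsub T l w|.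
  have [->|w0] := eqVneq w 0; first by rewrite normr0 mulr0.
  move=> /le_trans/(_ (rin_le _ _)); rewrite expr2 mulrCA ler_pM2l// normr_gt0//.
have hy : e * `|y| <= `|Tsub T l y|.
  apply: rin_ge; have : rin y (T y) <= (l - e) * `|y| ^+ 2.
    apply: form_le; rewrite pvm_disjoint//.
    apply/seteqP; split=> // t []/=; rewrite !in_itv/= andbT => t1 t2.
    by have := lt_le_trans t1 t2; rewrite ltxx.
  rewrite /Tsub rinBr rinZr rinxx => h.
  rewrite -[leRHS]normrN; apply: le_trans (ler_norm _); lra.
have hz : e * `|z| <= `|Tsub T l z|.
  apply: rin_ge; have : (l + e) * `|z| ^+ 2 <= rin z (T z).
    apply: form_ge; rewrite /z -pvm_setI//.
    apply: pvm_subset Ex; [|exact: measurable_itv|].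
      by apply: measurableI => //; exact: measurable_itv.
    by move=> t []/=; rewrite !in_itv/= => t1 /negP; rewrite -ltNge => ->.
  rewrite /Tsub rinBr rinZr rinxx => h.
  apply: le_trans (ler_norm _); lra.
rewrite -(@ler_pXn2r _ 2)// ?nnegrE ?mulr_ge0 ?(ltW e0)//.
rewrite exprMn (norm_pvm_split x mL) (norm_pvm_split (Tsub T l x) mL).
rewrite !pvm_Tsub// -/y -/z mulrDr -!exprMn.
by rewrite lerD// ler_pXn2r ?nnegrE ?mulr_ge0 ?(ltW e0).
Qed.

(* Applied with J = {l} and with J an interval around l. *)
Lemma coercive_pvm J l e x : measurable J -> 0 < e ->
  (forall z, E J z = 0 -> e * `|z| <= `|Tsub T l z|) ->
  Num.min (e ^+ 2) 1 * `|x| ^+ 2 <=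
    rin x (Tsub T l (Tsub T l x) + E J x).
Proof.
move=> mJ e0 he; have mC : measurable (~` J) by exact: measurableC.
rewrite rinDr rin_pvm// -sym_Tsub// rinxx (norm_pvm_split x mJ).
rewrite (norm_pvm_split (Tsub T l x) mJ) !pvm_Tsub//.
have JC : E J (E (~` J) x) = 0 by rewrite pvm_disjoint ?setICr.
have := he _ JC.
rewrite -(@ler_pXn2r _ 2)// ?nnegrE ?mulr_ge0 ?(ltW e0)// exprMn => h.
(* The term [E J x] contributes coefficient 1 on the range of [E J], and (T - l)^2 contributes e^2
   on its kernel. *)
set c := Num.min _ _.
have c1 : c <= 1 by rewrite ge_min lexx orbT.
have ce : c <= e ^+ 2 by rewrite ge_min lexx.
have h1 := ler_wpM2r (sqr_ge0 `|E J x|) c1.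
have h2 := ler_wpM2r (sqr_ge0 `|E (~` J) x|) ce.
have := sqr_ge0 `|Tsub T l (E J x)|; lra.
Qed.

(** * Spectral gaps, closed ranges and the Fredholm property *)

Definition gap l := exists2 e : R, 0 < e &
  forall x, E [set l] x = 0 -> e * `|x| <= `|Tsub T l x|.

(* [E {l}] is the projection onto [ker (T - l)], so this operator is invertible
   iff [(T - l)^2] is invertible on the orthogonal complement of that kernel. *)
Definition regularized l x : H := Tsub T l (Tsub T l x) + E [set l] x.

Lemma measurable_point l : measurable [set l : R].
Proof. exact: measurable_set1. Qed.

Lemma bop_sq_add J l : measurable J ->
  bounded_op (fun x => Tsub T l (Tsub T l x) + E J x).
Proof.
move=> mJ; have bS := bop_Tsub bT l.
by apply: bop_add; [exact: (bop_comp bS bS)|exact: pvm_bounded].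
Qed.

Lemma Tsub_pvm_point l x : Tsub T l (E [set l] x) = 0.
Proof. by apply/pvm_pointP; rewrite pvm_idem//; exact: measurable_point. Qed.

Lemma pvm_point_qpoly l x : E [set l] (qpoly T (qreal l) x) = 0.
Proof.
have m1 := measurable_point l.
by rewrite qpoly_real// !pvm_Tsub// Tsub_pvm_point (bop0 (bop_Tsub bT l)).
Qed.

Lemma qpoly_pvm_point l x : qpoly T (qreal l) (E [set l] x) = 0.
Proof. by rewrite qpoly_real// Tsub_pvm_point (bop0 (bop_Tsub bT l)). Qed.

Lemma minsq_gt0 (e : R) : 0 < e -> 0 < Num.min (e ^+ 2) 1.
Proof. by move=> e0; rewrite lt_min exprn_gt0//=. Qed.

Lemma gap_invertible l : gap l -> invertible_on setT (regularized l).
Proof.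
move=> [e e0 he]; have m1 := measurable_point l.
apply: (coercive_invertible (bop_sq_add l m1) (minsq_gt0 e0)) => x.
exact: coercive_pvm.
Qed.

Lemma invertible_gap l : invertible_on setT (regularized l) -> gap l.
Proof.
move=> [S bS SB]; have [M M0 hM] := bop_bound bS.
have [N N0 hN] := bop_bound (bop_Tsub bT l).
(* On ker E({l}), |x| <= M |(T - l)^2 x| <= M N |(T - l) x|. *)
exists (M * N)^-1; first by rewrite invr_gt0 mulr_gt0.
move=> x Px; rewrite ler_pdivrMl ?mulr_gt0// -{1}(SB x Logic.I).1.
rewrite (le_trans (hM _))// -mulrA ler_wpM2l ?(ltW M0)//.
by rewrite /regularized Px addr0.
Qed.

(** Coercivity solves ((T - l)^2 + E J) x = y; projecting the solution to ker E(J) removes the extra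
    term. *)
Lemma range_qpoly J l e y : measurable J -> 0 < e ->
  (forall z, E J z = 0 -> e * `|z| <= `|Tsub T l z|) -> E J y = 0 ->
  range (qpoly T (qreal l)) y.
Proof.
move=> mJ e0 he Jy.
have [x Bx] := coercive_surjective (bop_sq_add l mJ) (minsq_gt0 e0)
  (fun x => coercive_pvm x mJ e0 he) y.
exists (E (~` J) x) => //; have mC : measurable (~` J) by exact: measurableC.
rewrite qpoly_real// -!pvm_Tsub// -[RHS](pvm_setC_id mJ Jy) -Bx.
by rewrite [RHS](bopD (pvm_bounded mC)) [E (~` J) (E J x)]pvm_disjoint ?setICl ?addr0.
Qed.

(** With a gap the range is exactly ker E({l}). *)
Lemma gap_closed_range l : gap l -> closed (range (qpoly T (qreal l))).
Proof.
move=> [e e0 he]; have m1 := measurable_point l.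
rewrite (_ : range _ = qker (E [set l])); first exact/closed_qker/pvm_bounded.
apply/seteqP; split=> [_ [x _ <-]|y]; first exact: pvm_point_qpoly.
exact: range_qpoly he.
Qed.

(** The distance to the limit is |E(J_n) y|, and continuity from above of the scalar measure sends
    its square to |E({l}) y|^2 = 0. *)
Lemma pvm_shrink_cvg l y : E [set l] y = 0 ->
  (fun n => E (~` `]l - n.+1%:R^-1, l + n.+1%:R^-1[%classic) y) @ \oo --> y.
Proof.
move=> ly; set J := fun n : nat => `]l - n.+1%:R^-1, l + n.+1%:R^-1[%classic.
have mJ n : measurable (J n) by exact: measurable_itv.
have J1 : \bigcap_n J n = [set l].
  apply/seteqP; split=> [t Jt|_ -> n _]; last first.
    by rewrite /J /= in_itv/= ltrBlDr !ltrDl !invr_gt0 !ltr0Sn.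
  apply: contrapT => /eqP; rewrite -subr_eq0 -normr_gt0 => tl.
  have [n] := ltr_add_invr tl; rewrite add0r => nt.
  have := Jt n Logic.I; rewrite /J /= in_itv/= => /andP[t1 t2].
  move: nt t1 t2; move: (n.+1%:R^-1) => u nt t1 t2.
  by move: nt; rewrite ltNge ler_norml => /negP; apply; apply/andP; split; lra.
have [mu muE] := pvm_measure y.
have := @nonincreasing_cvg_mu _ _ _ mu J.
rewrite J1 [mu [set l]]muE ly normr0 expr0n muE ltry => /(_ isT mJ).
move=> /(_ (measurable_point l)) cv.
have {}cv : (mu \o J) n @[n --> \oo] --> 0%E.
  apply: cv => m n mn; apply/subsetPset => t; rewrite /J /= !in_itv/=.
  have : n.+1%:R^-1 <= m.+1%:R^-1 :> R.
    by rewrite lef_pV2 ?posrE// ler_nat.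
  move: (n.+1%:R^-1) (m.+1%:R^-1) => u v h /andP[t1 t2].
  by apply/andP; split; lra.
apply/cvgrPdist_lt => e e0.
have e20 : 0 < e ^+ 2 by rewrite exprn_gt0.
have /fine_cvgP[_ /cvgrPdist_lt/(_ _ e20)] := cv.
apply: filterS => n /=; rewrite muE /= sub0r normrN ger0_norm ?sqr_ge0// => h.
rewrite {1}(pvm_setC y (mJ n)) addrK -(@ltr_pXn2r _ 2)// ?nnegrE// ltW//.
Qed.

Lemma closed_range_invertible l : closed (range (qpoly T (qreal l))) ->
  invertible_on setT (regularized l).
Proof.
move=> cR; have m1 := measurable_point l; have bS := bop_Tsub bT l.
have kerR y : E [set l] y = 0 -> range (qpoly T (qreal l)) y.
  move=> ly; apply: (closed_cvg _ cR _ _ (pvm_shrink_cvg ly)); apply: nearW => n.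
  set J := `]_, _[%classic; have mJ : measurable J by exact: measurable_itv.
  have n0 : 0 < n.+1%:R^-1 :> R by rewrite invr_gt0.
  apply: (range_qpoly mJ n0); first by move=> z; exact: Tsub_ge.
  by rewrite pvm_disjoint ?setICr//; exact: measurableC.
apply: symmetric_bijective_invertible.
- exact: bop_sq_add.
- by move=> x y; rewrite /regularized rinDl rinDr !sym_Tsub// pvm_symmetric.
- move=> y; have [|x _ Qx] := kerR (y - E [set l] y).
    by rewrite (bopB (pvm_bounded m1)) pvm_idem// subrr.
  (* The component of [x] in ran E({l}) is exchanged for that of [y], since Q_l does not see it. *)
  exists (x - E [set l] x + E [set l] y).
  rewrite /regularized -qpoly_real// (bopD (bop_qpoly bT _)).
  rewrite (bopB (bop_qpoly bT _)) !qpoly_pvm_point subr0 addr0 Qx.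
  rewrite (bopD (pvm_bounded m1)) (bopB (pvm_bounded m1)) !pvm_idem//.
  by rewrite subrr add0r subrK.
- move=> x Bx; have : rin x (regularized l x) = 0 by rewrite Bx rin0r.
  rewrite /regularized rinDr rin_pvm// -sym_Tsub// rinxx => h.
  have h1 : `|Tsub T l x| ^+ 2 = 0.
    by have := sqr_ge0 `|Tsub T l x|; have := sqr_ge0 `|E [set l] x|; lra.
  have h2 : `|E [set l] x| ^+ 2 = 0 by lra.
  move/eqP: h1; rewrite sqrf_eq0 normr_eq0 => /eqP/pvm_pointP <-.
  by move/eqP: h2; rewrite sqrf_eq0 normr_eq0 => /eqP.
Qed.

Lemma range_pvm_point l : range (E [set l]) = qker (qpoly T (qreal l)).
Proof.
rewrite qker_qpoly_real//; apply/seteqP; split=> [_ [x _ <-]|x].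
  exact: Tsub_pvm_point.
by move/pvm_pointP => <-; exists x.
Qed.

Lemma fredholm_real l : fredholm (qpoly T (qreal l)) <->
  gap l /\ finite_qdim (range (E [set l])).
Proof.
rewrite fredholmP// range_pvm_point; split=> -[h fin]; split=> //.
  exact/invertible_gap/closed_range_invertible.
exact: gap_closed_range.
Qed.

(** * Isolated points of the spectrum *)

(** For 0 < |l - m| < e, the operator T - m is the scalar l - m on ran E({l}) and is bounded below
    by e - |l - m| on ker E({l}), so Q_m(T) is coercive. *)
Lemma gap_isolated l : gap l -> sspectrum T (qreal l) ->
  isolated [set m : R | sspectrum T (qreal m)] l.
Proof.
move=> [e e0 he] sl; have m1 := measurable_point l.
have mC : measurable (~` [set l : R]) by exact: measurableC.
split; first by rewrite inE.
exists (ball l e); first exact: nbhsx_ballx.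
apply/seteqP; split=> [m|_ ->]; last by split=> //; exact: ballxx.
move=> [/= ml]; apply: contraPP => /eqP nml.
have d0 : 0 < `|l - m| by rewrite normr_gt0 subr_eq0 eq_sym.
have de : 0 < e - `|l - m| by rewrite subr_gt0.
pose c := Num.min `|l - m| (e - `|l - m|).
have c0 : 0 < c by rewrite lt_min d0.
have c1 : c <= `|l - m| by rewrite ge_min lexx.
have c2 : c <= e - `|l - m| by rewrite ge_min lexx orbT.
apply: (qpoly_coercive bT sT (c := c ^+ 2)); first by rewrite exprn_gt0.
move=> x; rewrite /qnormim /= !expr0n /= !addr0 mul0r addr0 -exprMn.
rewrite exprMn (norm_pvm_split x m1) (norm_pvm_split (Tsub T m x) m1).
rewrite !pvm_Tsub// mulrDr -!exprMn lerD//.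
  rewrite ler_pXn2r ?nnegrE ?mulr_ge0 ?(ltW c0)//.
  have -> : Tsub T m (E [set l] x) = (l - m) *: E [set l] x.
    have := Tsub_pvm_point l x; rewrite /Tsub => /eqP; rewrite subr_eq0 => /eqP ->.
    by rewrite scalerBl.
  by rewrite normrZ ler_wpM2r.
rewrite ler_pXn2r ?nnegrE ?mulr_ge0 ?(ltW c0)//.
set z := E _ x; have lz : E [set l] z = 0 by rewrite pvm_disjoint ?setICr.
rewrite (le_trans (ler_wpM2r (normr_ge0 _) c2))// mulrBl.
rewrite lerBlDr (le_trans (he _ lz))//.
have -> : Tsub T l z = Tsub T m z - (l - m) *: z.
  by rewrite /Tsub scalerBl opprB addrA subrK.
by rewrite (le_trans (ler_normB _ _))// normrZ.
Qed.

(** Near [l] all other points are resolvent points, so E vanishes on the punctured interval. A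
    vector killed by E({l}) is thus killed by E(]l - e, l + e[), and [Tsub_ge] applies. *)
Lemma isolated_gap l : isolated [set m : R | sspectrum T (qreal m)] l -> gap l.
Proof.
move=> [_ [V /nbhs_ballP[e /= e0 eV] VI]].
have m1 := measurable_point l.
have mC : measurable (~` [set l : R]) by exact: measurableC.
have mJ : measurable `]l - e, l + e[%classic by exact: measurable_itv.
exists e => // x lx; apply: Tsub_ge => //.
rewrite -[LHS](pvm_setC_id m1); last first.
  by rewrite -pvm_setI// setIC pvm_setI// lx (bop0 (pvm_bounded mJ)).
rewrite -pvm_setI//; apply: pvm_local_null; first exact: measurableI.
move=> t [/= tl]; rewrite in_itv/= => tJ.
have [|d d0 hd] := @resolvent_null t; last by exists d.
move=> st; apply: tl.
suff : (V `&` [set m : R | sspectrum T (qreal m)]) t by rewrite VI.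
split=> //; apply: eV; rewrite /ball /= distrC ltr_distl.
by move/andP: tJ => [t1 t2]; apply/andP; split; lra.
Qed.

(** * Discrete points of the spectrum *)

Lemma qsphere_real l : qsphere (qreal l) = [set qreal l].
Proof.
have im0 : qabs (qim (qreal l)) = 0 by rewrite /qabs /= !expr0n /= !addr0 sqrtr0.
apply/seteqP; split=> [_ [I _ <-]|_ ->].
  by rewrite im0; apply: quat_eq => /=; ring.
exists (Quat 0 1 0 0); first by apply: quat_eq => /=; ring.
by rewrite im0; apply: quat_eq => /=; ring.
Qed.

Lemma invertible_on_scalar (W : set H) (A : H -> H) (k : R) : rsubmodule W ->
  k != 0 -> (forall x, W x -> A x = k *: x) -> invertible_on W A.
Proof.
move=> sW k0 Ak; exists (fun x => k^-1 *: x).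
  split=> [x Wx|x y a _ _|].
  - by rewrite -rscale_real; exact: rsubmoduleZ.
  - by rewrite scalerDr scale_rscale.
  - by exists `|k^-1| => x _; rewrite normrZ.
move=> x Wx; rewrite Ak// scalerA mulVf// scale1r; split=> //.
rewrite Ak; first by rewrite scalerA divff// scale1r.
by rewrite -rscale_real; exact: rsubmoduleZ.
Qed.

Lemma gap_discrete l : gap l -> finite_qdim (range (E [set l])) ->
  sspectrum T (qreal l) -> discrete_sspectrum T (qreal l).
Proof.
move=> gl fin sl; split=> //; have m1 := measurable_point l.
have bP := pvm_bounded m1; have bQ := bop_qpoly bT (qreal l).
have rangeP x : range (E [set l]) x <-> E [set l] x = x.
  by split=> [[y _ <-]|<-]; [rewrite pvm_idem|exists x].
have rE : range (E [set l]) = [set x | E [set l] x = x].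
  by apply/seteqP; split=> x /rangeP.
have sW1 : rsubmodule (range (E [set l])).
  split=> [|x y a /rangeP xE /rangeP yE]; first by apply/rangeP; exact: bop0.
  by apply/rangeP; rewrite (bopD bP) (bopZq bP) xE yE.
have sW2 : rsubmodule (qker (E [set l])).
  split=> [|x y a]; rewrite /qker /=; first exact: bop0.
  by move=> xE yE; rewrite (bopD bP) (bopZq bP) xE yE rscale0l addr0.
have W1_scalar q x : range (E [set l]) x ->
    qpoly T q x = ((l - qre q) ^+ 2 + qnormim q) *: x.
  move=> /rangeP/pvm_pointP Tx; have {}Tx m : Tsub T m x = (l - m) *: x.
    by move: Tx; rewrite /Tsub => /eqP; rewrite subr_eq0 => /eqP ->; rewrite scalerBl.
  by rewrite qpolyE// Tx (bopZ (bop_Tsub bT _)) Tx scalerA -expr2 scalerDl.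
have spec1 : sspectrum_on (range (E [set l])) T = [set qreal l].
  apply/seteqP; split=> [q sq|_ -> [S bS SQ]].
    apply: contrapT => ql; apply: sq; apply: invertible_on_scalar => //; last first.
      by move=> x; exact: W1_scalar.
    apply: contra_notN ql => /eqP k0; rewrite /qnormim in k0.
    have := sqr_ge0 (l - qre q); have := sqr_ge0 (qi q).
    have := sqr_ge0 (qj q); have := sqr_ge0 (qk q) => h1 h2 h3 h4.
    have z (r : R) : r ^+ 2 = 0 -> r = 0 by move=> /eqP; rewrite sqrf_eq0 => /eqP.
    apply: quat_eq => /=; [|apply: z; lra|apply: z; lra|apply: z; lra].
    have : l - qre q = 0 by apply: z; lra.
    lra.
  have Q0 x : range (E [set l]) x -> qpoly T (qreal l) x = 0.
    by move=> /W1_scalar ->; rewrite /qnormim /= subrr !expr0n /= !addr0 scale0r.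
  (* Q_l vanishes on ran E({l}); if it were invertible there, that range would be 0, [regularized]
     would equal Q_l, and [l] would leave the spectrum. *)
  have P0 x : E [set l] x = 0.
    have W0 : range (E [set l]) 0 := sW1.1.
    have Wx : range (E [set l]) (E [set l] x) by exists x.
    rewrite -(SQ _ Wx).1 Q0// -{1}(Q0 _ W0); exact: (SQ _ W0).1.
  apply: sl; have [S' bS' SB] := gap_invertible gl; exists S' => // x _.
  have := SB x Logic.I; rewrite /regularized !P0 !addr0.
  by rewrite !qpoly_real.
exists (range (E [set l])), (qker (E [set l])); split.
- split; split=> //; last exact: closed_qker.
  by rewrite rE; exact: closed_fixpoints.
- split=> x.
    by move=> /rangeP xE; apply/rangeP; rewrite pvm_commute// xE.
  by rewrite /qker /= pvm_commute// => ->; exact: bop0.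
- split.
    apply/seteqP; split=> [x [/rangeP xE]|_ ->]; first by rewrite /qker /= xE.
    by split; [exact: sW1.1|exact: sW2.1].
  exists (E [set l]) => // x; split; first by exists x.
  by rewrite /qker /= (bopB bP) pvm_idem// subrr.
- exact: fin.
- rewrite qsphere_real spec1; split=> //.
  apply/seteqP; split=> // _ [/= ->]; apply.
  have [S bS SB] := gap_invertible gl.
  (* Applying E({l}) to [regularized l (S x) = x] kills the Q_l term and leaves E({l}) (S x) = 0. *)
  have SW x : qker (E [set l]) x -> qker (E [set l]) (S x).
    move=> lx; have := (SB x Logic.I).2; rewrite /regularized -qpoly_real// => Sx.
    have : E [set l] (qpoly T (qreal l) (S x) + E [set l] (S x)) = 0 by rewrite Sx.
    by rewrite (bopD bP) pvm_point_qpoly add0r pvm_idem.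
  exists S; first split=> //.
  + by move=> x y a _ _; rewrite (bopD bS) (bopZq bS).
  + by have [M M0 hM] := bop_bound bS; exists M.
  + move=> x lx; have := SB x Logic.I; rewrite /regularized -!qpoly_real//.
    by rewrite lx addr0 [E _ (S x)]SW// addr0.
Qed.

Lemma discrete_fredholm q : discrete_sspectrum T q -> fredholm (qpoly T q).
Proof.
move=> [sq]; have := sspectrum_real bT sT sq; set l := qre q => ql.
rewrite {}ql in sq *.
move=> [W1 [W2 [[[_ sW1] [_ sW2]] [TW1 TW2] [W12 [P bP hP]] fin []]]].
rewrite qsphere_real => disj spec1.
have bQ := bop_qpoly bT (qreal l); set Q := qpoly T (qreal l) in bQ *.
(* [qreal l] is in the spectrum on [W1], so disjointness excludes it from the one on [W2]. *)
have [S bS SQ] : invertible_on W2 Q.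
  apply: contrapT => sq2.
  have : (sspectrum_on W1 T `&` sspectrum_on W2 T) (qreal l) by rewrite spec1.
  by rewrite disj.
have S0 := bop_on0 sW2 bS.
have QW W : rsubmodule W -> (forall x, W x -> W (T x)) ->
    forall x, W x -> W (Q x).
  move=> sW TW x Wx; rewrite /Q /qpoly; apply: rsubmoduleD => //.
    apply: rsubmoduleB => //; first exact: (TW _ (TW _ Wx)).
    by rewrite -rscale_real; apply: rsubmoduleZ => //; exact: TW.
  by rewrite -rscale_real; exact: rsubmoduleZ.
have Puniq u v : W1 u -> W2 v -> P (u + v) = u.
  move=> Wu Wv; have [h1 h2] := hP (u + v).
  have : (W1 `&` W2) (P (u + v) - u).
    split; first exact: rsubmoduleB.
    have -> : P (u + v) - u = v - (u + v - P (u + v)).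
      by rewrite opprB addrCA opprD [- u + _]addrC addNKr.
    exact: rsubmoduleB.
  by rewrite W12 => /eqP; rewrite subr_eq0 => /eqP.
(* Both summands are invariant under [Q], and [P] is determined by the decomposition. *)
have PQ x : P (Q x) = Q (P x).
  have [h1 h2] := hP x; rewrite -{1}(subrK (P x) x) addrC (bopD bQ).
  by rewrite Puniq//; exact: QW.
have [s sE] := (finite_qdimP W1).1 fin.
apply/fredholmP => //; split.
  have QW1 : Q @` W1 = rspan (map Q s).
    rewrite sE; apply: image_rspan; first exact: bop0.
    by move=> v w a _ _; rewrite (bopD bQ) (bopZq bQ).
  (* [Q] is onto on [W2], so only the [W1] component restricts membership in the range. *)
  rewrite (_ : range Q = P @^-1` rspan (map Q s)).
    apply: preimage_closed; last exact: closed_rspan.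
    by move=> x _; exact: bop_continuous.
  rewrite -QW1; apply/seteqP; split=> [_ [x _ <-]|x [w Ww Qw]].
    by exists (P x); [exact: (hP x).1|rewrite PQ].
  exists (w + S (x - P x)) => //.
  by rewrite (bopD bQ) Qw (SQ _ (hP x).2).2 addrC subrK.
have kerW1 : qker Q `<=` W1.
  move=> x; rewrite /qker /= => Qx; have [h1 h2] := hP x.
  have : x - P x = 0.
    rewrite -(SQ _ h2).1 (bopB bQ) Qx -PQ Qx (bop0 bP) subrr; exact: S0.
  by move/eqP; rewrite subr_eq0 => /eqP ->.
have bE1 := pvm_bounded (measurable_point l).
(* The kernel is ran E({l}) and lies in [W1], so it is the image of [W1] under E({l}), hence
   finitely generated. *)
rewrite -range_pvm_point; apply/finite_qdimP; exists (map (E [set l]) s).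
rewrite -image_rspan -?sE; [|exact: bop0|].
  apply/seteqP; split=> [x|_ [x _ <-]]; last by exists x.
  rewrite range_pvm_point => Qx; exists x; first exact: kerW1.
  by apply/pvm_pointP; move: Qx; rewrite qker_qpoly_real.
by move=> v w a _ _; rewrite (bopD bE1) (bopZq bE1).
Qed.

End SpectralMeasure.

(** * Comparison of the essential, Weyl and discrete spectra *)

Theorem theorem5p4 (R : realType) (H : qhilbertType R) (T : H -> H)
    (E : set R -> H -> H)
    (Hseparable : exists2 D : set H, countable D & dense D)
    (Hinfinite : ~ finite_qdim [set: H])
    (Tbounded : bounded_op T) (Tselfadjoint : adjoint T = T)
    (TE : spectral_measure T E) :
  [/\ ess_sspectrum T = sspectrum T `\` discrete_sspectrum T,
      ess_sspectrum T =
        [set qreal l | l in [set l : R | sspectrum T (qreal l) /\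
          (~ isolated [set m : R | sspectrum T (qreal m)] l \/
           ~ finite_qdim (range (E [set l])))]],
      sspectrum T = weyl_sspectrum T `|` discrete_sspectrum T
    & sspectrum T `\` weyl_sspectrum T = discrete_sspectrum T].
Proof.
have sT := adjoint_symmetric Tselfadjoint.
have essE : ess_sspectrum T = sspectrum T `\` discrete_sspectrum T.
  apply/seteqP; split=> q.
    move=> nF; split; last by move/(discrete_fredholm Tbounded sT TE).
    by apply: contrapT => /(invertible_fredholm Tbounded sT).
  move=> [sq nd] F; apply: nd; have ql := sspectrum_real Tbounded sT sq.
  rewrite ql in sq F *.
  have [gl fin] := (fredholm_real Tbounded sT TE _).1 F.
  exact: gap_discrete TE _ gl fin sq.
have weylE : weyl_sspectrum T = ess_sspectrum T.
  by apply/seteqP; split=> q nF /(fredholm0P Tbounded sT).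
have discS : discrete_sspectrum T `<=` sspectrum T by move=> q [].
split=> //.
- apply/seteqP; split=> q.
    move=> nF; have sq : sspectrum T q by rewrite essE in nF; exact: nF.1.
    have ql := sspectrum_real Tbounded sT sq; rewrite ql in sq nF *.
    exists (qre q) => //; split=> //.
    have [iso|] := pselect (isolated [set m : R | sspectrum T (qreal m)] (qre q));
      last by left.
    right=> fin; apply: nF; apply/(fredholm_real Tbounded sT TE); split=> //.
    exact: isolated_gap iso.
  move=> [l [sl nl] <-] F.
  have [gl fin] := (fredholm_real Tbounded sT TE _).1 F.
  by case: nl => //; apply; exact: gap_isolated TE _ gl sl.
- rewrite weylE essE; apply/seteqP; split=> q.
    by move=> sq; have [|] := pselect (discrete_sspectrum T q); [right|left].
  by move=> [[]|/discS].
- rewrite weylE essE; apply/seteqP; split=> q.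
    by move=> [sq nE]; apply: contrapT => nd; apply: nE.
  by move=> dq; split; [exact: discS|case].
Qed.
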